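(* For any $\varepsilon\in(0,1)$ (which may depend on $n$), there is a randomized algorithm in the LOCAL model which, on any $n$-node graph $G=(V,E)$ with non-negative vertex weights $w_0:V\to\mathbb{R}_{\ge 0}$, runs in $O\!\left(\frac{\log n}{\log^2\log n}+\frac{\log n\,\log(1/\varepsilon)}{\log^3\log n}\right)$ rounds and, with probability at least $1-n^{-c}$ for some constant $c\ge 1$, outputs a vertex cover $S\subseteq V$ with $\sum_{v\in S}w_0(v)\le (2+\varepsilon)\,OPT$, where $OPT$ is the minimum total weight of a vertex cover of $G$. *)

(* Defs.v *)
From HB Require Import structures.
From mathcomp Require Import all_boot all_order all_algebra.
From mathcomp Require Import all_classical all_reals all_analysis.
Set Implicit Arguments. Unset Strict Implicit. Unset Printing Implicit Defensive.
Import Order.TTheory GRing.Theory Num.Theory.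
Local Open Scope ring_scope.

(* Graphs on the vertex set 'I_n = {0,..,n-1}; the vertex index doubles as the
   unique identifier of the node in the LOCAL model. *)
Definition simple_graph (n : nat) (e : rel 'I_n) : Prop :=
  symmetric e /\ irreflexive e.

Fixpoint ball (n : nat) (e : rel 'I_n) (v : 'I_n) (k : nat) : {set 'I_n} :=
  match k with
  | 0 => [set v]
  | k'.+1 => ball e v k' :|: [set y | [exists x in ball e v k', e x y]]
  end.

(* A randomized algorithm on n-node graphs with real vertex weights, where each
   node privately draws an independent uniform random value in 'I_K; its output
   at node v says whether v joins the cover. *)
Definition rand_alg (R : realType) (n K : nat) : Type :=
  rel 'I_n -> ('I_n -> R) -> {ffun 'I_n -> 'I_K} -> 'I_n -> bool.

(* LOCAL model, T rounds: the output of v only depends on the information v can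
   gather in T rounds, i.e. the edges incident to nodes at distance <= T-1 and
   the inputs (weights, random values) of nodes at distance <= T. *)
Definition local_in_rounds (R : realType) (n K T : nat) (A : rand_alg R n K) : Prop :=
  forall (e e' : rel 'I_n) (w w' : 'I_n -> R) (r r' : {ffun 'I_n -> 'I_K}) (v : 'I_n),
    simple_graph e -> simple_graph e' ->
    (forall x y, (0 < T)%N -> x \in ball e v T.-1 -> e x y = e' x y) ->
    (forall x, x \in ball e v T -> w x = w' x /\ r x = r' x) ->
    A e w r v = A e' w' r' v.

Definition is_vertex_cover (n : nat) (e : rel 'I_n) (S : {set 'I_n}) : Prop :=
  forall x y, e x y -> (x \in S) || (y \in S).

Definition set_weight (R : realType) (n : nat) (w : 'I_n -> R) (S : {set 'I_n}) : R :=
  \sum_(v in S) w v.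

(* Minimum weight of a vertex cover (setT is always a cover). *)
Definition OPT_vc (R : realType) (n : nat) (e : rel 'I_n) (w : 'I_n -> R) : R :=
  \big[Order.min/set_weight w [set: 'I_n]%SET]_(S : {set 'I_n} |
      [forall x, forall y, e x y ==> (x \in S) || (y \in S)]) set_weight w S.

Definition output_set (R : realType) (n K : nat) (A : rand_alg R n K)
  (e : rel 'I_n) (w : 'I_n -> R) (r : {ffun 'I_n -> 'I_K}) : {set 'I_n} :=
  [set v | A e w r v].

Definition success_prob (R : realType) (n K : nat) (A : rand_alg R n K)
  (e : rel 'I_n) (w : 'I_n -> R) (eps : R) : R :=
  (#|[set r : {ffun 'I_n -> 'I_K} |
       [forall x, forall y, e x y ==> (x \in output_set A e w r) || (y \in output_set A e w r)]
       && (set_weight w (output_set A e w r) <= (2 + eps) * OPT_vc e w)]|)%:R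
  / (#|{ffun 'I_n -> 'I_K}|)%:R.

(* Main.v *)
(** One run of the procedure below finds an edge packing that exhausts, for every
    edge, all but a fraction [2^-a] of the weight of one endpoint, where [a] is of
    order [log (log n)].  After [O(1 + log(1/eps)/a)] runs on the residual weights,
    every edge has an endpoint that keeps at most [eps/4] of its weight; by weak
    duality these endpoints form a [(2 + eps)]-approximate cover.

    A run takes [O(log n / a^2)] rounds.  The balls around [v] hold at most [n]
    vertices, so over [a] dyadic scales there is an index [i < 2^a] for which the
    ball of radius [4i] grows in four steps by a factor [n^(O(1/(a i)))] only.  The
    vertex [v] hands its edges to the vertex of least random rank near it at that
    scale.  The edges handed to one center with one index [i] form a piece; a
    piece has radius [O(i)], and with high probability a vertex touches only
    [n^(O(1/(a i)))] pieces of index [i], up to polylogarithmic factors.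

    Each vertex bids a share of its weight in each piece, at first inversely
    proportional to the number of pieces, and the center of the piece pays a
    maximal packing under these bids every [O(i)] rounds.  An exhausted bid is
    multiplied by [2^a], hence [O(log n / (a^2 i))] packings suffice, that is,
    [O(log n / a^2)] rounds whatever [i] is.  When the bids of a vertex become too
    large for its weight, all of them are divided by [4^a]; this happens only
    polylogarithmically often, because each raise follows a payment of the same
    order. *)

From HB Require Import structures.
From mathcomp Require Import all_boot all_order all_algebra.
From mathcomp Require Import all_classical all_reals all_analysis.
From mathcomp Require Import zify ring lra.
Require Import Defs.
Import Order.TTheory GRing.Theory Num.Theory.
Local Open Scope ring_scope.

Set Implicit Arguments.
Unset Strict Implicit.
Unset Printing Implicit Defensive.

(** * Maximal edge packings under vertex capacities *)

Section Packing.
Context {R : realFieldType} {V : finType}.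
Implicit Types (E : {set V * V}) (o : V -> R) (y : V * V -> R) (v : V).

(** Edges are ordered pairs; both orientations count, so it does not matter which one a piece
    stores. *)
Definition pack_load y v : R := \sum_u (y (u, v) + y (v, u)).

Definition is_maximal_packing E o y : Prop :=
  [/\ forall p, 0 <= y p, forall p, p \notin E -> y p = 0,
      forall v, pack_load y v <= o v
    & forall p, p \in E -> pack_load y p.1 = o p.1 \/ pack_load y p.2 = o p.2].

Lemma pack_loadD y z v :
  pack_load (fun p => y p + z p) v = pack_load y v + pack_load z v.
Proof. by rewrite -big_split; apply: eq_bigr => u _; rewrite addrACA. Qed.

Lemma pack_load_single (p : V * V) (d : R) v : p.1 != p.2 ->
  pack_load (fun q => if q == p then d else 0) v =
  if (v == p.1) || (v == p.2) then d else 0.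
Proof.
case: p => a b /= ab; rewrite /pack_load big_split /=.
have -> : \sum_u (if (u, v) == (a, b) then d else 0) = if v == b then d else 0.
  rewrite (bigD1 a) //= xpair_eqE eqxx /= big1 ?addr0 // => u ua.
  by rewrite xpair_eqE (negPf ua).
have -> : \sum_u (if (v, u) == (a, b) then d else 0) = if v == a then d else 0.
  rewrite (bigD1 b) //= xpair_eqE eqxx andbT big1 ?addr0 // => u ub.
  by rewrite xpair_eqE (negPf ub) andbF.
have [->|va] := eqVneq v a; first by rewrite (negPf ab) add0r.
by case: eqP => _ /=; rewrite addr0.
Qed.

(** Greedy induction on the edges: the new edge receives the smaller slack of its two endpoints.
    Loads only grow and stay under [o], so endpoints saturated before remain saturated. *)
Lemma maximal_packing_exists E o : (forall v, 0 <= o v) ->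
  (forall p, p \in E -> p.1 != p.2) -> exists y, is_maximal_packing E o y.
Proof.
move=> o0; have [k] := ubnP #|E|; elim: k E => // k IH E /ltnSE-Ek irE.
have [->|[p pE]] := set_0Vmem E.
  exists (fun _ => 0); split=> // [v|q]; last by rewrite inE.
  by rewrite /pack_load big1 // => u _; rewrite addr0.
have [|q /setD1P[_ qE]|y [y0 yE yo ymax]] := IH (E :\ p); last 1 first.
- pose d := Num.min (o p.1 - pack_load y p.1) (o p.2 - pack_load y p.2).
  have d0 : 0 <= d by rewrite le_min !subr_ge0 !yo.
  have pp := irE p pE.
  exists (fun q => y q + if q == p then d else 0); split.
  + by move=> q; case: eqP => _; rewrite addr_ge0.
  + move=> q qE; case: eqP qE => [->|/eqP qp qE]; first by rewrite pE.
    by rewrite addr0 yE // !inE negb_and qE orbT.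
  + move=> v; rewrite pack_loadD pack_load_single //.
    case: ifP => [/orP[]/eqP->|_]; last by rewrite addr0.
    * by rewrite -lerBrDl ge_min lexx.
    * by rewrite -lerBrDl ge_min lexx orbT.
  + move=> q qE; rewrite !pack_loadD !pack_load_single //.
    have [->|qp] := eqVneq q p.
      rewrite !eqxx orbT /= /d.
      case: leP => _; [left|right]; lra.
    have le v : pack_load y v + (if (v == p.1) || (v == p.2) then d else 0) <= o v.
      case: ifP => [/orP[]/eqP->|_]; last by rewrite addr0.
      * by rewrite -lerBrDl ge_min lexx.
      * by rewrite -lerBrDl ge_min lexx orbT.
    have ge v : pack_load y v = o v ->
        pack_load y v + (if (v == p.1) || (v == p.2) then d else 0) = o v.
      move=> yv; apply/eqP; rewrite eq_le le -{1}yv lerDl.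
      by case: ifP => _; [exact: d0 | exact: lexx].
    by case: (ymax q); rewrite ?inE ?qp // => /ge; [left|right].
- by rewrite (cardsD1 p) pE in Ek.
- exact: irE.
Qed.

(* A choice of packing that is a function of [E] and [o] alone, so that all
   vertices of a piece agree on it. *)
Definition maximal_packing E o : V * V -> R :=
  xget (fun _ => 0) [set y | is_maximal_packing E o y].

Lemma maximal_packingP E o : (forall v, 0 <= o v) ->
  (forall p, p \in E -> p.1 != p.2) -> is_maximal_packing E o (maximal_packing E o).
Proof. by move=> o0 irE; exact: (xgetPex _ (maximal_packing_exists o0 irE)). Qed.

End Packing.

(** * The bidding process in the pieces *)

Definition touches (V : finType) (E : {set V * V}) (v : V) : bool :=
  [exists p in E, (p.1 == v) || (p.2 == v)].

(** [level] is the exponent of the raise factor in the current bid, [drops] counts the common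
    reductions of all bids of a vertex, and [pending] holds the bids under which the next packing of
    a piece is computed. *)
Record bidding (R : Type) (V Q : Type) := Bidding {
  paid : V -> R; level : V -> Q -> nat; drops : V -> nat; pending : V -> Q -> R }.

Section Process.
Context {R : realFieldType} {V Q C : finType}.
(** Pieces of one class share the period [tau]. A vertex starts from the shares [b], keeps its total
    bid within the fraction [theta] of its weight, and is finished once at most the fraction [delta]
    is unpaid. *)
Variables (cl : Q -> C) (tau : C -> nat) (b : Q -> R) (alpha theta delta : R).
Variables (E : Q -> {set V * V}) (w : V -> R).
Implicit Types (s : bidding R V Q) (v u : V) (q : Q) (t : nat) (k : V -> Q -> nat).

Definition offer k v q : R :=
  if touches (E q) v then w v * b q * alpha ^+ k v q else 0.

Definition acts t q : bool := (tau (cl q) %| t)%N.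

Definition payment t s v q : R :=
  if acts t q then pack_load (maximal_packing (E q) (pending s ^~ q)) v else 0.

Definition raised_level t s v q : nat :=
  (level s v q + (acts t q && (offer (level s) v q <= payment t s v q)%R))%N.

Definition overbid t s v : bool :=
  theta * w v < \sum_q offer (raised_level t s) v q.

(** A drop costs two levels; the truncated subtraction never takes a bid below its base share. *)
Definition next_level t s v q : nat :=
  (raised_level t s v q - (overbid t s v).*2)%N.

Definition next_paid t s v : R := paid s v + \sum_q payment t s v q.

(* The bids of a piece are fixed one period before they are used: this is the
   time that the center needs to collect them and to announce the packing. *)
Definition bid_step t s : bidding R V Q := {|
  paid := next_paid t s;
  level := next_level t s;
  drops := fun v => (drops s v + overbid t s v)%N;
  pending := fun v q => if acts t q then
      (if next_paid t s v < (1 - delta) * w v then offer (next_level t s) v q else 0)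
    else pending s v q |}.

Definition bid_start : bidding R V Q := {|
  paid := fun=> 0; level := fun _ _ => 0%N; drops := fun=> 0%N;
  pending := offer (fun _ _ => 0%N) |}.

Fixpoint bid_run t : bidding R V Q :=
  if t is t'.+1 then bid_step t (bid_run t') else bid_start.

Hypothesis w_ge0 : forall v, 0 <= w v.
Hypothesis b_ge0 : forall q, 0 <= b q.
Hypothesis alpha_ge4 : 4 <= alpha.
Hypothesis theta_gt0 : 0 < theta.
Hypothesis theta_le1 : theta <= 1.
Hypothesis theta_delta : theta * #|C|%:R <= delta.
Hypothesis irrE : forall q p, p \in E q -> p.1 != p.2.
Hypothesis base : forall v, \sum_(q | touches (E q) v) b q <= theta / 4.

Let alpha_ge0 : 0 <= alpha. Proof. by move: alpha_ge4; lra. Qed.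
Let alpha_ge1 : 1 <= alpha. Proof. by move: alpha_ge4; lra. Qed.
Let alpha_gt0 : 0 < alpha. Proof. by move: alpha_ge4; lra. Qed.

Lemma offer_ge0 k v q : 0 <= offer k v q.
Proof. by rewrite /offer; case: ifP => // _; rewrite !mulr_ge0 ?exprn_ge0. Qed.

Lemma pending_ge0 t v q : 0 <= pending (bid_run t) v q.
Proof.
elim: t v q => [|t IH] v q /=; first exact: offer_ge0.
by case: ifP => // _; case: ifP => // _; exact: offer_ge0.
Qed.

Lemma payment_ge0 t v q s : (forall v q, 0 <= pending s v q) -> 0 <= payment t s v q.
Proof.
move=> s0; rewrite /payment; case: ifP => // _.
have [y0 _ _ _] := maximal_packingP (s0 ^~ q) (@irrE q).
by rewrite /pack_load sumr_ge0 // => u _; rewrite addr_ge0.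
Qed.

Lemma payment_le t v q s : (forall v q, 0 <= pending s v q) ->
  payment t s v q <= if acts t q then pending s v q else 0.
Proof.
move=> s0; rewrite /payment; case: ifP => // _.
by have [_ _ le _] := maximal_packingP (s0 ^~ q) (@irrE q); apply: le.
Qed.

Lemma offer_untouched k v q : ~~ touches (E q) v -> offer k v q = 0.
Proof. by rewrite /offer => /negPf->. Qed.

Lemma sum_offer k v : \sum_q offer k v q =
  \sum_(q | touches (E q) v) w v * b q * alpha ^+ k v q.
Proof. by rewrite /offer -big_mkcond. Qed.

Lemma sum_base_le v : \sum_q offer (fun _ _ => 0%N) v q <= theta / 4 * w v.
Proof.
rewrite sum_offer (eq_bigr (fun q => w v * b q)); last by move=> q _; rewrite mulr1.
by rewrite -mulr_sumr mulrC ler_wpM2r.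
Qed.

(** A raise requires a payment of at least the current bid, so the raised bid is at most [alpha]
    times that payment. *)
Lemma raised_sum_le t s v : (forall v q, 0 <= pending s v q) ->
  \sum_q offer (raised_level t s) v q <=
  \sum_q offer (level s) v q + alpha * \sum_q payment t s v q.
Proof.
move=> s0; rewrite mulr_sumr -big_split; apply: ler_sum => q _ /=.
have P0 := payment_ge0 t v q s0.
have aP0 : 0 <= alpha * payment t s v q by rewrite mulr_ge0.
have [/andP[at_q xp]|no] :=
    boolP (acts t q && (offer (level s) v q <= payment t s v q)).
  apply: (@le_trans _ _ (alpha * offer (level s) v q)); last first.
    by apply: ler_wpDl; [exact: offer_ge0 | rewrite ler_wpM2l].
  rewrite {1}/offer /raised_level at_q xp /offer.
  by case: ifP => _; [rewrite addn1 exprS mulrCA | rewrite mulr0].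
have -> : offer (raised_level t s) v q = offer (level s) v q.
  by rewrite /offer /raised_level (negPf no) addn0.
by rewrite lerDl.
Qed.

Lemma raised_sum_le_scale t s v :
  \sum_q offer (raised_level t s) v q <= alpha * \sum_q offer (level s) v q.
Proof.
rewrite mulr_sumr; apply: ler_sum => q _; rewrite /offer; case: ifP => _; last by rewrite mulr0.
rewrite [leRHS]mulrCA ler_wpM2l ?mulr_ge0 // -exprS ler_weXn2l //.
by rewrite /raised_level -addn1 leq_add2l leq_b1.
Qed.

(** After the drop a bid is at most its base share plus [alpha ^-2] times the raised bid. Relative
    to [w v], the base shares sum to at most [theta / 4] and the rest to at most
    [theta / alpha <= theta / 4]. *)
Lemma dropped_sum_le t s v : \sum_q offer (level s) v q <= theta * w v ->
  overbid t s v -> \sum_q offer (next_level t s) v q <= theta / 2 * w v.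
Proof.
move=> le ov; have X1 := raised_sum_le_scale t s v.
apply: (@le_trans _ _ (\sum_q offer (fun _ _ => 0%N) v q +
    alpha ^-2 * \sum_q offer (raised_level t s) v q)).
  rewrite mulr_sumr -big_split; apply: ler_sum => q _ /=.
  rewrite /offer /next_level ov; case: ifP => _; last by rewrite mulr0 addr0.
  set k := raised_level _ _ _ _.
  have wb0 : 0 <= w v * b q by rewrite mulr_ge0.
  rewrite mulr1 mulrCA -[X in X + _]mulr1 -mulrDr ler_wpM2l //.
  have [k2|k2] := leqP 2 k.
    rewrite -[in leRHS](subnK k2) exprD mulrCA mulVf ?mulr1 ?lerDr //.
    by rewrite expf_neq0 // gt_eqF.
  have -> : (k - true.*2)%N = 0%N by apply/eqP; rewrite subn_eq0 ltnW.
  by rewrite expr0 lerDl mulr_ge0 ?invr_ge0 ?exprn_ge0.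
have aX : alpha ^-2 * \sum_q offer (raised_level t s) v q <= theta / 4 * w v.
  rewrite ler_pdivrMl ?exprn_gt0 //.
  apply: (le_trans X1); apply: (@le_trans _ _ (alpha * (theta * w v))).
    by rewrite ler_wpM2l.
  have tw0 : 0 <= theta * w v by rewrite mulr_ge0 // ltW.
  rewrite (_ : _ * (theta / 4 * w v) = alpha * (theta * w v) * (alpha / 4)); last by ring.
  by rewrite ler_peMr ?mulr_ge0 // ?(ltW theta_gt0) // ler_pdivlMr ?mul1r.
have := sum_base_le v; lra.
Qed.

(** An overbid sum exceeds [theta * w v] and falls to at most half of that, so each drop consumes
    [theta / 2 * w v] of the sum of bids. *)
Lemma next_sum_le t s v : (forall v q, 0 <= pending s v q) ->
  \sum_q offer (level s) v q <= theta * w v ->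
  \sum_q offer (next_level t s) v q <= theta * w v /\
  (overbid t s v)%:R * (theta / 2 * w v) + \sum_q offer (next_level t s) v q <=
  \sum_q offer (level s) v q + alpha * \sum_q payment t s v q.
Proof.
move=> s0 le; have X1 := raised_sum_le t v s0.
have tw0 : 0 <= theta * w v by rewrite mulr_ge0 // ltW.
have [ov|nov] := boolP (overbid t s v).
  have := dropped_sum_le le ov; move: ov; rewrite /overbid /=; split; lra.
have -> : \sum_q offer (next_level t s) v q = \sum_q offer (raised_level t s) v q.
  by apply: eq_bigr => q _; rewrite /offer /next_level (negPf nov) subn0.
by move: nov; rewrite /overbid -leNgt mul0r add0r; split.
Qed.

Lemma level_sum_le t v : \sum_q offer (level (bid_run t)) v q <= theta * w v.
Proof.
elim: t => [|t IH]; last by have [] := next_sum_le t.+1 (pending_ge0 t) IH.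
apply: (le_trans (sum_base_le v)); rewrite ler_wpM2r //.
by have := theta_gt0; lra.
Qed.

(** The sum of bids is a potential: payments add at most [alpha] times their amount, and each drop
    removes at least [theta / 2 * w v]. As at most [w v] is ever paid, a vertex of positive weight
    has only [O(alpha / theta)] drops. *)
Lemma drops_potential t v :
  (drops (bid_run t) v)%:R * (theta / 2 * w v) + \sum_q offer (level (bid_run t)) v q
  <= theta / 4 * w v + alpha * paid (bid_run t) v.
Proof.
elim: t => [|t IH] /=; first by rewrite mul0r add0r mulr0 addr0 sum_base_le.
have [_] := next_sum_le t.+1 (pending_ge0 t) (level_sum_le t v).
rewrite /next_paid natrD mulrDl mulrDr; lra.
Qed.

(** All pieces of a class fix their bids at the same moments, so one instance of [level_sum_le]
    bounds them together. Different classes are out of step, which costs the factor [#|C|] in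
    [pending_sum_le]. *)
Lemma class_pending_le t v c :
  \sum_(q | cl q == c) pending (bid_run t) v q <= theta * w v.
Proof.
elim: t => [|t IH] /=.
  apply: le_trans (level_sum_le 0 v).
  by rewrite [leRHS](bigID (fun q => cl q == c)) /= lerDl sumr_ge0 // => q _; exact: offer_ge0.
have [act|nact] := boolP (tau c %| t.+1)%N; last first.
  rewrite (eq_bigr (pending (bid_run t) v)) // => q /eqP qc.
  by rewrite /acts qc (negPf nact).
rewrite (eq_bigr (fun q => if next_paid t.+1 (bid_run t) v < (1 - delta) * w v
    then offer (next_level t.+1 (bid_run t)) v q else 0)); last first.
  by move=> q /eqP qc; rewrite /acts qc act.
case: (ltP (next_paid t.+1 (bid_run t) v)) => _; last by rewrite big1 // mulr_ge0 // ltW.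
apply: le_trans (level_sum_le t.+1 v).
by rewrite [leRHS](bigID (fun q => cl q == c)) /= lerDl sumr_ge0 // => q _; exact: offer_ge0.
Qed.

Lemma pending_sum_le t v : \sum_q pending (bid_run t) v q <= delta * w v.
Proof.
rewrite (partition_big cl xpredT) //=.
apply: (@le_trans _ _ (\sum_(c : C) theta * w v)).
  by apply: ler_sum => c _; exact: class_pending_le.
by rewrite sumr_const -mulr_natr mulrAC ler_wpM2r.
Qed.

Lemma paid_ge0 t v : 0 <= paid (bid_run t) v.
Proof.
elim: t => [|t IH] //=; rewrite addr_ge0 // sumr_ge0 // => q _.
by apply: payment_ge0; exact: pending_ge0.
Qed.

(** New bids are fixed only while less than [(1 - delta) * w v] is paid, and pending bids total at
    most [delta * w v]. A finished vertex only settles bids that are already pending, and those are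
    then cleared. *)
Lemma paid_pending_le t v :
  paid (bid_run t) v + \sum_q pending (bid_run t) v q <= w v.
Proof.
have dw : delta * w v <= w v + (delta - 1) * w v by lra.
elim: t => [|t IH].
  rewrite add0r; apply: le_trans (sum_base_le v) _.
  by have := theta_le1; have := w_ge0 v; nra.
have := pending_sum_le t.+1 v; rewrite /=.
case: (ltP _ ((1 - delta) * w v)) => [alive|dead] pe.
  by move: pe alive; rewrite /next_paid; lra.
apply: le_trans IH; rewrite /next_paid -addrA lerD2l -big_split.
apply: ler_sum => q _ /=; have := payment_le t.+1 v q (pending_ge0 t).
have := pending_ge0 t v q.
by case: ifP => _; rewrite ?addr0 // => p0; rewrite -{2}(add0r (pending _ _ _)) lerD2r.
Qed.

Lemma paid_le t v : paid (bid_run t) v <= w v.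
Proof.
apply: le_trans (paid_pending_le t v).
by rewrite lerDl sumr_ge0 // => q _; exact: pending_ge0.
Qed.

Definition active t v := paid (bid_run t) v < (1 - delta) * w v.

Lemma active_prev t v : active t.+1 v -> active t v.
Proof.
apply: le_lt_trans; rewrite /= /next_paid lerDl sumr_ge0 // => q _.
by apply: payment_ge0; exact: pending_ge0.
Qed.

(** Between two payments of a piece its level can only drop, so the bid fixed earlier is at least
    the current one; a payment that exhausts it therefore causes a raise. *)
Lemma offer_pending t v q : active t v ->
  offer (level (bid_run t)) v q <= pending (bid_run t) v q.
Proof.
elim: t => [|t IH] // act'; have act := active_prev act'; move: act' (IH act).
rewrite /active /= => alive le; case: ifP => nq; first by rewrite alive.
apply: le_trans le.
rewrite /offer; case: ifP => // _; rewrite ler_wpM2l ?mulr_ge0 // ler_weXn2l //.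
by rewrite /next_level /raised_level nq addn0 leq_subr.
Qed.

(** A drop lowers the level by at most two, so [level + 2 * drops] never decreases and advances with
    every raise. *)
Let level_drop_le (l d : nat) (a o : bool) :
  (l + d.*2 + a <= (l + a - o.*2) + (d + o).*2)%N.
Proof. by case: a; case: o; lia. Qed.

Let progress_le (a x y k l1 l2 l1' l2' : nat) : (a <= x + y)%N -> (k <= l1 + l2)%N ->
  (l1 + x <= l1')%N -> (l2 + y <= l2')%N -> (a + k <= l1' + l2')%N.
Proof. lia. Qed.

(** Whenever the piece acts, maximality exhausts the pending bid of one endpoint of [p], which then
    raises; the clock [level + 2 * drops] of that endpoint advances. *)
Lemma edge_progress t q p : p \in E q -> active t p.1 -> active t p.2 ->
  (t %/ tau (cl q) <= (level (bid_run t) p.1 q + (drops (bid_run t) p.1).*2) +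
                      (level (bid_run t) p.2 q + (drops (bid_run t) p.2).*2))%N.
Proof.
move=> pE; have [tau0|tau_gt0] := posnP (tau (cl q)); first by rewrite tau0 divn0.
elim: t => [|t IH] act1' act2'; first by rewrite div0n.
have act1 := active_prev act1'; have act2 := active_prev act2'.
have step v : (level (bid_run t) v q + (drops (bid_run t) v).*2 +
    (acts t.+1 q && (offer (level (bid_run t)) v q <= payment t.+1 (bid_run t) v q)%R) <=
    level (bid_run t.+1) v q + (drops (bid_run t.+1) v).*2)%N.
  exact: level_drop_le.
apply: (@leq_trans ((tau (cl q) %| t.+1) + t %/ tau (cl q))%N); first by rewrite divnS.
apply: progress_le (IH act1 act2) (step p.1) (step p.2).
have [at_q|nat_q] := boolP (acts t.+1 q); last by rewrite /acts in nat_q; rewrite (negPf nat_q).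
rewrite /payment at_q /=.
have [_ _ _ mx] := maximal_packingP ((pending_ge0 t) ^~ q) (@irrE q).
have -> : (tau (cl q) %| t.+1)%N = true by [].
by case: (mx p pE) => ->; rewrite offer_pending ?addn1 ?add1n.
Qed.

(** If both endpoints were active, a level above [k] would break [level_sum_le] and more than [d]
    drops would break [drops_potential]. Each clock is then at most [k + 2 * d], which bounds the
    number of packings. *)
Lemma bid_run_tight t q p (k d : nat) : p \in E q ->
  theta < b q * alpha ^+ k.+1 -> theta / 4 + alpha < d.+1%:R * (theta / 2) ->
  (2 * k + 4 * d < t %/ tau (cl q))%N ->
  (1 - delta) * w p.1 <= paid (bid_run t) p.1 \/
  (1 - delta) * w p.2 <= paid (bid_run t) p.2.
Proof.
move=> pE hk hd ht.
have bnd v : touches (E q) v -> active t v ->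
    (level (bid_run t) v q + (drops (bid_run t) v).*2 <= k + 2 * d)%N.
  move=> tv act.
  have w0 : 0 < w v.
    rewrite lt_neqAle w_ge0 andbT; apply/eqP => wv0; move: act.
    by rewrite /active -wv0 mulr0 ltNge paid_ge0.
  have lk : (level (bid_run t) v q <= k)%N.
    rewrite leqNgt; apply/negP => kl; have := level_sum_le t v; apply/negP; rewrite -ltNge.
    rewrite (bigD1 q) //= ltr_wpDr ?sumr_ge0 //; first by move=> *; exact: offer_ge0.
    rewrite /offer tv [ltLHS]mulrC -mulrA ltr_pM2l //.
    by apply: (lt_le_trans hk); rewrite ler_wpM2l // ler_weXn2l.
  have dl : (drops (bid_run t) v <= d)%N.
    rewrite leqNgt; apply/negP => dl; have := drops_potential t v; apply/negP; rewrite -ltNge.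
    rewrite ltr_wpDr ?sumr_ge0 //; first by move=> *; exact: offer_ge0.
    apply: (@le_lt_trans _ _ ((theta / 4 + alpha) * w v)).
      by rewrite mulrDl lerD2l ler_wpM2l // paid_le.
    rewrite mulrA ltr_pM2r //; apply: (lt_le_trans hd).
    by rewrite ler_wpM2r ?ler_nat // divr_ge0 // ltW.
  by rewrite leq_add // mul2n leq_double.
have [a1|] := boolP (active t p.1); last by rewrite /active -leNgt; left.
have [a2|] := boolP (active t p.2); last by rewrite /active -leNgt; right.
have t1 : touches (E q) p.1 by apply/existsP; exists p; rewrite pE eqxx.
have t2 : touches (E q) p.2 by apply/existsP; exists p; rewrite pE eqxx orbT.
move: ht; rewrite ltnNge; case/negP; apply: (leq_trans (edge_progress pE a1 a2)).
by apply: (leq_trans (leq_add (bnd _ t1 a1) (bnd _ t2 a2))); clear; lia.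
Qed.

Definition is_packing_load (F : pred (V * V)) (l : V -> R) : Prop :=
  exists y : V * V -> R, [/\ forall p, 0 <= y p, forall p, ~~ F p -> y p = 0
    & forall v, l v = pack_load y v].

Lemma paid_packing t (F : pred (V * V)) : (forall q p, p \in E q -> F p) ->
  is_packing_load F (paid (bid_run t)).
Proof.
move=> EF; elim: t => [|t [y [y0 yF ld]]].
  by exists (fun=> 0); split=> //= v; rewrite /pack_load big1 // => u _; rewrite addr0.
pose z q := maximal_packing (E q) (pending (bid_run t) ^~ q).
have zP q : is_maximal_packing (E q) (pending (bid_run t) ^~ q) (z q).
  by apply: maximal_packingP; [move=> v; exact: pending_ge0 | exact: irrE].
exists (fun p => y p + \sum_(q | acts t.+1 q) z q p); split=> [p|p pF|v].
- by rewrite addr_ge0 // sumr_ge0 // => q _; have [] := zP q.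
- rewrite yF // add0r big1 // => q _; have [_ zE _ _] := zP q; apply: zE.
  by apply: contraNN pF; exact: EF.
- rewrite pack_loadD /= /next_paid ld; congr (_ + _).
  rewrite /payment -big_mkcond /pack_load exchange_big /=.
  by apply: eq_bigr => u _; rewrite big_split.
Qed.

End Process.

(** * Repeated runs on residual weights, and weak duality *)

Section LocalRatio.
Context {R : realFieldType} {V : finType}.
Implicit Types (F : pred (V * V)) (l w : V -> R) (S : {set V}).

Lemma packing_load_ge0 F l v : is_packing_load F l -> 0 <= l v.
Proof.
by move=> [y [y0 _ ->]]; rewrite /pack_load sumr_ge0 // => u _; rewrite addr_ge0.
Qed.

Lemma packing_loadD F l l' : is_packing_load F l -> is_packing_load F l' ->
  is_packing_load F (fun v => l v + l' v).
Proof.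
move=> [y [y0 yF yl]] [z [z0 zF zl]]; exists (fun p => y p + z p); split=> [p|p pF|v].
- by rewrite addr_ge0.
- by rewrite yF // zF // addr0.
- by rewrite pack_loadD yl zl.
Qed.

(** The loads add up to twice the total value of the packing, and each edge contributes its value to
    the load of at least one endpoint in [S]. *)
Lemma packing_load_cover F l S :
  is_packing_load F l -> (forall p, F p -> (p.1 \in S) || (p.2 \in S)) ->
  \sum_v l v <= 2 * \sum_(v in S) l v.
Proof.
move=> [y [y0 yF yl]] cov; pose A := \sum_v \sum_u y (u, v).
have sumy : \sum_v \sum_u y (v, u) = A by rewrite exchange_big.
have -> : \sum_v l v = 2 * A.
  rewrite (eq_bigr (pack_load y)) // /pack_load.
  under eq_bigr do rewrite big_split.
  by rewrite big_split /= sumy -/A; ring.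
rewrite ler_pM2l // big_mkcond /=.
rewrite (_ : \sum_v _ = \sum_v \sum_u
    ((if v \in S then y (u, v) else 0) + (if v \in S then y (v, u) else 0))); last first.
  apply: eq_bigr => v _; case: ifP => _; last by rewrite big1 // => u _; rewrite addr0.
  by rewrite yl.
under eq_bigr do rewrite big_split.
rewrite big_split /= [X in _ + X]exchange_big -big_split /=.
apply: ler_sum => v _; rewrite -big_split /=; apply: ler_sum => u _.
have [uv|nuv] := boolP (F (u, v)); last by rewrite yF //; do 2 case: ifP; rewrite addr0.
by have := cov _ uv; rewrite /=; case: (u \in S); case: (v \in S) => //= _;
  rewrite ?lerDl ?addr0 ?add0r.
Qed.

Variables (F : pred (V * V)) (run : (V -> R) -> V -> R) (delta : R) (w0 : V -> R).
Hypothesis delta_ge0 : 0 <= delta.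
Hypothesis delta_le1 : delta <= 1.
Hypothesis w0_ge0 : forall v, 0 <= w0 v.
Hypothesis run_packing : forall w, (forall v, 0 <= w v) -> is_packing_load F (run w).
Hypothesis run_le : forall w, (forall v, 0 <= w v) -> forall v, run w v <= w v.
Hypothesis run_tight : forall w, (forall v, 0 <= w v) -> forall p, F p ->
  (1 - delta) * w p.1 <= run w p.1 \/ (1 - delta) * w p.2 <= run w p.2.

Fixpoint residual (r : (V -> R) -> V -> R) (w : V -> R) k : V -> R :=
  if k is k'.+1 then
    (fun v => residual r w k' v - r (residual r w k') v)
  else w.

Notation res := (residual run w0).

Lemma residual_ge0 k v : 0 <= res k v.
Proof. by elim: k v => [|k IH] v //=; rewrite subr_ge0 run_le. Qed.

Lemma residual_packing k : is_packing_load F (fun v => w0 v - res k v).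
Proof.
elim: k => [|k IH].
  exists (fun=> 0); split=> // v.
  by rewrite subrr /pack_load big1 // => u _; rewrite addr0.
have := packing_loadD IH (run_packing (residual_ge0 k)).
by congr is_packing_load; apply/funext => v /=; ring.
Qed.

(** Each run shrinks the residual of one endpoint by the factor [delta] while the other does not
    grow; [i] and [j] count the runs credited to either endpoint. *)
Lemma residual_decay k p : F p -> exists i j,
  [/\ (k <= i + j)%N, res k p.1 <= delta ^+ i * w0 p.1 & res k p.2 <= delta ^+ j * w0 p.2].
Proof.
move=> Fp; elim: k => [|k [i [j [ij le1 le2]]]].
  by exists 0%N, 0%N; rewrite !expr0 !mul1r.
have dec v : res k.+1 v <= res k v.
  by rewrite /= gerBl; apply: packing_load_ge0 (run_packing (residual_ge0 k)).
have sq v h : res k v <= delta ^+ h * w0 v -> (1 - delta) * res k v <= run (res k) v ->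
    res k.+1 v <= delta ^+ h.+1 * w0 v.
  move=> le tight; apply: (@le_trans _ _ (delta * res k v)).
    by rewrite /=; move: tight; lra.
  by rewrite exprS -mulrA ler_wpM2l.
case: (run_tight (residual_ge0 k) Fp) => tight.
  exists i.+1, j; split; [by rewrite addSn | exact: sq | exact: le_trans (dec _) le2].
exists i, j.+1; split; [by rewrite addnS | exact: le_trans (dec _) le1 | exact: sq].
Qed.

Definition tight_set (eps : R) k : {set V} := [set v | res k v <= eps / 4 * w0 v].

(** Pigeonhole: of [2 * m] runs, at least [m] are credited to one endpoint. *)
Lemma tight_set_cover eps m p : delta ^+ m <= eps / 4 -> F p ->
  (p.1 \in tight_set eps m.*2) || (p.2 \in tight_set eps m.*2).
Proof.
move=> de Fp; have [i [j [ij le1 le2]]] := residual_decay m.*2 Fp.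
have small v h : (m <= h)%N -> res m.*2 v <= delta ^+ h * w0 v ->
    v \in tight_set eps m.*2.
  move=> mh le; rewrite inE; apply: (le_trans le); rewrite ler_wpM2r //.
  by apply: le_trans de; rewrite ler_wiXn2l.
have [mi|im] := leqP m i; first by rewrite (small _ i).
by rewrite (small p.2 j) ?orbT //; clear -ij im; lia.
Qed.

Lemma tight_set_weight eps k S : 0 < eps < 1 ->
  (forall p, F p -> (p.1 \in S) || (p.2 \in S)) ->
  \sum_(v in tight_set eps k) w0 v <= (2 + eps) * \sum_(v in S) w0 v.
Proof.
move=> /andP[e0 e1] cov; have pk := residual_packing k.
have tight : (1 - eps / 4) * \sum_(v in tight_set eps k) w0 v <=
    \sum_v (w0 v - res k v).
  rewrite mulr_sumr [leRHS](bigID (mem (tight_set eps k))) /=.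
  rewrite ler_wpDr ?sumr_ge0 //; first by move=> v _; apply: packing_load_ge0 pk.
  by apply: ler_sum => v; rewrite inE; lra.
have upper : \sum_v (w0 v - res k v) <= 2 * \sum_(v in S) w0 v.
  apply: (le_trans (packing_load_cover pk cov)); rewrite ler_pM2l //.
  by apply: ler_sum => v _; rewrite gerBl residual_ge0.
have W0 : 0 <= \sum_(v in S) w0 v by rewrite sumr_ge0.
have q0 : 0 < 1 - eps / 4 by lra.
rewrite -(ler_pM2l q0); apply: (le_trans tight); apply: (le_trans upper).
(* The threshold [eps / 4] is small enough that [2 <= (1 - eps / 4) * (2 + eps)]. *)
by rewrite mulrA ler_wpM2r //; nra.
Qed.

End LocalRatio.

(** * Balls and agreement of neighbourhoods *)

Section Ball.
Context {n : nat}.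
Implicit Types (e : rel 'I_n) (u v x y : 'I_n).

Lemma ball_center e v k : v \in ball e v k.
Proof. by elim: k => [|k IH] /=; rewrite !inE ?IH. Qed.

Lemma ball_leq e v k l : (k <= l)%N -> ball e v k \subset ball e v l.
Proof.
elim: l => [|l IH]; first by rewrite leqn0 => /eqP->.
rewrite leq_eqVlt => /orP[/eqP-> //|]; rewrite ltnS => /IH kl.
exact: fintype.subset_trans kl (finset.subsetUl _ _).
Qed.

Lemma ball_mem_leq e v k l x : (k <= l)%N -> x \in ball e v k -> x \in ball e v l.
Proof. by move=> /ball_leq /fintype.subsetP; apply. Qed.

Lemma ball_edge e v k x y : x \in ball e v k -> e x y -> y \in ball e v k.+1.
Proof.
by move=> xv xy /=; rewrite !inE; apply/orP; right; apply/existsP; exists x; rewrite xv.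
Qed.

Lemma ballS e v k y : y \in ball e v k.+1 ->
  y \in ball e v k \/ exists2 x, x \in ball e v k & e x y.
Proof.
rewrite /= !inE => /orP[|/existsP[x /andP[xv xy]]]; first by left.
by right; exists x.
Qed.

Lemma ball_add e v u x k l :
  u \in ball e v k -> x \in ball e u l -> x \in ball e v (k + l)%N.
Proof.
move=> uv; elim: l x => [|l IH] x; first by rewrite addn0 /= inE => /eqP->.
rewrite addnS => /ballS[/IH|[y /IH yv yx]]; first exact: ball_mem_leq.
exact: ball_edge yv yx.
Qed.

Lemma ball1_edge e u v : e u v -> v \in ball e u 1.
Proof. exact: ball_edge (ball_center e u 0). Qed.

Lemma ball_sym e u v k : symmetric e -> u \in ball e v k -> v \in ball e u k.
Proof.
move=> se; elim: k u => [|k IH] u; first by rewrite /= !inE eq_sym.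
move=> /ballS[/IH|[x /IH xv xu]]; first exact: ball_mem_leq.
by rewrite -add1n; apply: ball_add xv; apply: ball1_edge; rewrite se.
Qed.

End Ball.

Section Agree.
Context {n : nat} {T : Type}.
Implicit Types (e : rel 'I_n) (f : 'I_n -> T) (u v x y : 'I_n).

(** Edges leaving the ball are compared too, so agreement to radius [d] determines balls up to
    radius [d.+1]. *)
Definition agree e e' f f' v d : Prop :=
  forall x, x \in ball e v d -> (forall y, e x y = e' x y) /\ f x = f' x.

Lemma agree_sub e e' f f' v u k d :
  u \in ball e v k -> agree e e' f f' v (k + d) -> agree e e' f f' u d.
Proof. by move=> uv ag x xu; apply: ag; exact: ball_add uv xu. Qed.

Lemma agree_leq e e' f f' v k d : (k <= d)%N ->
  agree e e' f f' v d -> agree e e' f f' v k.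
Proof. by move=> kd ag x xu; apply: ag; exact: ball_mem_leq kd xu. Qed.

Lemma agree_ball e e' f f' v k d : agree e e' f f' v d -> (k <= d.+1)%N ->
  ball e v k = ball e' v k.
Proof.
move=> ag; elim: k => //= k IH kd; have bE := IH (ltnW kd).
rewrite -bE; congr (_ :|: _); apply/setP => y; rewrite !inE.
apply: eq_existsb => x; case: (boolP (x \in ball e v k)) => //= xv.
by have [-> _] := ag x (ball_mem_leq (kd : (k <= d)%N) xv).
Qed.

Lemma agree_sym e e' f f' v d : agree e e' f f' v d -> agree e' e f' f v d.
Proof.
by move=> ag x; rewrite -(agree_ball ag (leqnSn d)) => /ag[ee ff]; split=> // y; rewrite ee.
Qed.

End Agree.

(** * Slow ball growth and the partition of the edges into pieces *)

Definition growth_exp (a l i : nat) : nat := (l %/ (a * 2 ^ trunc_log 2 i)).+1.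

(* If the growth exceeded [2 ^ growth_exp a l i] for all [i] in the dyadic block
   of [j], it would exceed [2 ^ (l / a)] on that block, and [2 ^ l] in total. *)
Lemma slow_growth (a l : nat) (f : nat -> nat) :
  (0 < a)%N -> (0 < f 1)%N -> (f (2 ^ a) < 2 ^ l)%N ->
  exists2 i, (0 < i < 2 ^ a)%N & (f i.+1 <= 2 ^ growth_exp a l i * f i)%N.
Proof.
move=> a0 f0 fl.
have [/existsP[i /andP[i0 fi]]|] :=
  boolP [exists i : 'I_(2 ^ a), (0 < i)%N && (f i.+1 <= 2 ^ growth_exp a l i * f i)%N].
  by exists (val i) => //; rewrite i0 ltn_ord.
rewrite negb_exists => /forallP fast.
have {}fast i : (0 < i)%N -> (i < 2 ^ a)%N -> (2 ^ growth_exp a l i * f i <= f i.+1)%N.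
  move=> i0 ia; have := fast (Ordinal ia); rewrite /= i0 /= -ltnNge.
  exact: ltnW.
have block j : (j <= a)%N ->
    exists2 s, (j * l <= a * s)%N & (2 ^ s <= f (2 ^ j))%N.
  elim: j => [|j IH] ja; first by exists 0%N.
  (* [trunc_log 2] is constant on the block that starts at [2 ^ j], so the single exponent [g]
     serves all its [2 ^ j] steps; together they add [2 ^ j * g >= l / a]. *)
  have [s sl fs] := IH (ltnW ja); pose g := (l %/ (a * 2 ^ j)).+1.
  have inblock h : (h <= 2 ^ j)%N -> (2 ^ (s + h * g) <= f (2 ^ j + h))%N.
    elim: h => [|h IHh] hj; first by rewrite mul0n !addn0.
    have i0 : (0 < 2 ^ j + h)%N by rewrite addn_gt0 expn_gt0.
    have jh : (2 ^ j + h < 2 ^ j.+1)%N by rewrite expnS mul2n -addnn ltn_add2l.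
    have ia : (2 ^ j + h < 2 ^ a)%N by rewrite (leq_trans jh) // leq_exp2l.
    have tl : trunc_log 2 (2 ^ j + h) = j.
      by apply: trunc_log_eq => //; rewrite leq_addr jh.
    have := fast _ i0 ia; rewrite /growth_exp tl -/g -addnS; apply: leq_trans.
    by rewrite mulSn addnCA expnD leq_mul // IHh // ltnW.
  exists (s + 2 ^ j * g)%N; last by rewrite expnS mul2n -addnn inblock.
  rewrite mulSn mulnDr addnC leq_add // mulnA mulnC ltnW // ltn_ceil //.
  by rewrite muln_gt0 a0 expn_gt0.
have [s sl fs] := block a (leqnn a).
have := leq_ltn_trans fs fl; rewrite ltn_exp2l // => sl'.
by move: sl; rewrite leq_pmul2l // leqNgt sl'.
Qed.

Section Pieces.
Context {n K : nat}.
Variables (a l : nat).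
Implicit Types (e : rel 'I_n) (r : {ffun 'I_n -> 'I_K}) (u v x y : 'I_n) (i : 'I_(2 ^ a)).

Definition slow_at e v (i : nat) : bool :=
  (0 < i)%N && (#|ball e v (4 * i.+1)| <= 2 ^ growth_exp a l i * #|ball e v (4 * i)|)%N.

Definition slow_index e v : 'I_(2 ^ a) :=
  odflt (Ordinal (expn_gt0 2 a)) [pick i : 'I_(2 ^ a) | slow_at e v i].

(** The radius [4 * i + 2] is midway between the two radii compared in [slow_at];
    [piece_touch_count] uses the two steps of slack on either side. *)
Definition piece_center e r v : 'I_n :=
  odflt v [pick x in ball e v (4 * slow_index e v + 2)
          | [forall y in ball e v (4 * slow_index e v + 2), (r x <= r y)%N]].

Definition piece e r v : 'I_(2 ^ a) * 'I_n := (slow_index e v, piece_center e r v).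

(** An edge belongs to its endpoint of smaller identifier, so it lies in one piece only, and in one
    orientation. *)
Definition piece_edges e r (q : 'I_(2 ^ a) * 'I_n) : {set 'I_n * 'I_n} :=
  [set p | [&& e p.1 p.2, (p.1 < p.2)%N & piece e r p.1 == q]].

(* Contains the centers of all pieces of index [i] that touch a neighbor of [v]. *)
Definition early e r v (i : nat) : {set 'I_n} :=
  [set x in ball e v (4 * i.+1) | [forall y in ball e v (4 * i), (r x <= r y)%N]].

Lemma slow_indexP e v : (0 < a)%N -> (n < 2 ^ l)%N -> slow_at e v (slow_index e v).
Proof.
move=> a0 nl; rewrite /slow_index; case: pickP => //= none.
have [||i /andP[i0 ia] fi] := @slow_growth a l (fun k => #|ball e v (4 * k)|) a0.
- by apply/card_gt0P; exists v; exact: ball_center.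
- by apply: leq_ltn_trans nl; rewrite -[leqRHS]card_ord max_card.
- by have := none (Ordinal ia); rewrite /slow_at /= i0 fi.
Qed.

Lemma piece_centerP e r v : let k := (4 * slow_index e v + 2)%N in
  piece_center e r v \in ball e v k /\
  forall y, y \in ball e v k -> (r (piece_center e r v) <= r y)%N.
Proof.
rewrite /piece_center /=; case: pickP => [x /andP[xv /forall_inP mx]|none] //=.
have vv := ball_center e v (4 * slow_index e v + 2).
have [x xv mx] := arg_minnP (fun x => val (r x)) vv.
case/negP: (negbT (none x)); apply/andP; split=> //.
by apply/forall_inP => y /mx.
Qed.

Lemma piece_edges_irr e r q p : p \in piece_edges e r q -> p.1 != p.2.
Proof. by rewrite inE => /and3P[_ lt _]; apply: contraTneq lt => ->; rewrite ltnn. Qed.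

Lemma piece_edges_cover e r p : symmetric e -> irreflexive e -> e p.1 p.2 ->
  exists q, p \in piece_edges e r q \/ (p.2, p.1) \in piece_edges e r q.
Proof.
move=> se ie ep; have := ltngtP p.1 p.2; case=> [lt|gt|/val_inj eqp].
- by exists (piece e r p.1); left; rewrite inE ep lt eqxx.
- by exists (piece e r p.2); right; rewrite inE /= se ep gt eqxx.
- by move: ep; rewrite eqp ie.
Qed.

Lemma touchesP (V : finType) (E : {set V * V}) (v : V) :
  reflect (exists2 p, p \in E & p.1 = v \/ p.2 = v) (touches E v).
Proof.
apply: (iffP existsP) => [[p /andP[pE /orP[]/eqP pv]]|[p pE []<-]].
- by exists p; auto.
- by exists p; auto.
- by exists p; rewrite pE eqxx.
- by exists p; rewrite pE eqxx orbT.
Qed.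

Lemma touches_piece e r q u : symmetric e -> touches (piece_edges e r q) u ->
  exists2 v, v \in ball e u 1 & piece e r v = q.
Proof.
move=> se /touchesP[p]; rewrite inE => /and3P[ep _ /eqP pq] [<-|<-]; exists p.1 => //.
  exact: ball_center.
by apply: ball1_edge; rewrite se.
Qed.

(** A vertex within one step of [u] and the vertex [p.1] share a center at distance at most
    [4 * i + 2] from each, and [1 + 2 * (4 * i + 2) = 8 * i + 5]. *)
Lemma piece_diameter e r q u p : symmetric e -> touches (piece_edges e r q) u ->
  p \in piece_edges e r q -> p.1 \in ball e u (8 * q.1 + 5) /\ p.2 \in ball e u (8 * q.1 + 6).
Proof.
move=> se /(touches_piece se)[v vu vq]; rewrite inE => /and3P[ep _ /eqP pq].
have p1 : p.1 \in ball e u (8 * q.1 + 5).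
  have [cv _] := piece_centerP e r v; have [cp _] := piece_centerP e r p.1.
  have cE : piece_center e r v = q.2 by rewrite -vq.
  have cE' : piece_center e r p.1 = q.2 by rewrite -pq.
  have iE : slow_index e v = q.1 by rewrite -vq.
  have iE' : slow_index e p.1 = q.1 by rewrite -pq.
  move: cv cp; rewrite iE iE' cE cE' => cv /(ball_sym se) cp.
  apply: ball_mem_leq (ball_add vu (ball_add cv cp)).
  by clear; lia.
by split=> //; rewrite (_ : _ + 6 = (8 * q.1 + 5).+1)%N; [exact: ball_edge p1 ep | rewrite -addnS].
Qed.

(** Two vertices [v0] and [v] next to [u] are within two steps of each other. If both have index
    [i], the center of [v] lies within [4 * i + 4] of [v0], and no rank within [4 * i] of [v0] is
    smaller than its own; so all these centers are early for one fixed [v0]. *)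
Lemma piece_touch_count e r u i D : symmetric e -> (0 < a)%N -> (n < 2 ^ l)%N ->
  (forall v, slow_at e v i -> #|early e r v i| <= D)%N ->
  (#|[set c | touches (piece_edges e r (i, c)) u]| <= D)%N.
Proof.
move=> se a0 nl hD.
have [->|[c0]] := set_0Vmem [set c | touches (piece_edges e r (i, c)) u].
  by rewrite cards0.
rewrite inE => /(touches_piece se)[v0 v0u [iv0 _]].
apply: leq_trans (hD v0 _); last by rewrite -iv0; exact: slow_indexP.
apply: subset_leq_card; apply/fintype.subsetP => c.
rewrite finset.in_set => /(touches_piece se)[v vu [iv cv]].
have [cb cm] := piece_centerP e r v; rewrite iv cv in cb cm.
rewrite finset.in_set; apply/andP; split.
  apply: ball_mem_leq (ball_add (ball_sym se v0u) (ball_add vu cb)).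
  by clear; lia.
apply/forall_inP => y yv0; apply: cm.
apply: ball_mem_leq (ball_add (ball_sym se vu) (ball_add v0u yv0)).
by clear; lia.
Qed.

Section Local.
Variables (e e' : rel 'I_n) (r r' : {ffun 'I_n -> 'I_K}).

Lemma slow_index_local v d : agree e e' r r' v d -> (4 * 2 ^ a <= d.+1)%N ->
  slow_index e v = slow_index e' v.
Proof.
move=> ag ad; rewrite /slow_index; congr odflt; apply: eq_pick => i.
rewrite /slow_at; have ia := ltn_ord i.
by rewrite !(agree_ball ag) //; apply: leq_trans ad; rewrite leq_mul2l // ltnW.
Qed.

Lemma piece_local v d : agree e e' r r' v d -> (4 * 2 ^ a <= d)%N ->
  piece e r v = piece e' r' v.
Proof.
move=> ag ad; have iE := slow_index_local ag (leqW ad).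
rewrite /piece iE; congr pair; rewrite /piece_center iE; congr odflt.
set k := (_ + 2)%N.
have kd : (k <= d)%N.
  apply: leq_trans ad; apply: (@leq_trans (4 * (slow_index e' v).+1)).
    by rewrite /k mulnS addnC leq_add2r.
  by rewrite leq_mul2l ltn_ord orbT.
have kd1 := leqW kd; apply: eq_pick => x /=; rewrite -(agree_ball ag kd1).
case: (boolP (x \in ball e v k)) => //= xv.
have [_ ->] := ag x (ball_mem_leq kd xv).
apply: eq_forallb => y; case: (boolP (y \in ball e v k)) => //= yv.
by have [_ ->] := ag y (ball_mem_leq kd yv).
Qed.

Lemma piece_edges_local v d p q : agree e e' r r' v d -> (4 * 2 ^ a <= d)%N ->
  p.1 = v -> (p \in piece_edges e r q) = (p \in piece_edges e' r' q).
Proof.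
move=> ag ad pv; rewrite !inE pv (piece_local ag ad).
by have [-> _] := ag v (ball_center e v d).
Qed.

End Local.

Lemma touches_local_imp e e' r r' u d q : symmetric e ->
  agree e e' r r' u d.+1 -> (4 * 2 ^ a <= d)%N ->
  touches (piece_edges e r q) u -> touches (piece_edges e' r' q) u.
Proof.
move=> se ag ad /touchesP[p pE pu]; apply/touchesP; exists p => //.
have p1u : p.1 \in ball e u 1.
  move: pE; rewrite inE => /and3P[ep _ _].
  by case: pu => <-; [exact: ball_center | apply: ball1_edge; rewrite se].
by rewrite -(piece_edges_local q (agree_sub p1u ag)).
Qed.

Lemma touches_local e e' r r' u d q : symmetric e -> symmetric e' ->
  agree e e' r r' u d.+1 -> (4 * 2 ^ a <= d)%N ->
  touches (piece_edges e r q) u = touches (piece_edges e' r' q) u.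
Proof.
move=> se se' ag ad; apply/idP/idP; first exact: touches_local_imp ag ad.
exact: touches_local_imp (agree_sym ag) ad.
Qed.

Lemma piece_edges_eq e e' r r' u d (q : 'I_(2 ^ a) * 'I_n) : symmetric e -> symmetric e' ->
  agree e e' r r' u (8 * q.1 + 5 + d) -> (4 * 2 ^ a <= d)%N ->
  touches (piece_edges e r q) u -> piece_edges e r q = piece_edges e' r' q.
Proof.
move=> se se' ag ad tu.
have ag1 : agree e e' r r' u d.+1 by apply: agree_leq ag; clear; lia.
have tu' : touches (piece_edges e' r' q) u by rewrite -(touches_local q se se' ag1 ad).
apply/setP => p; apply/idP/idP => pE.
  have [p1 _] := piece_diameter se tu pE.
  by rewrite -(piece_edges_local q (agree_sub p1 ag) ad erefl).
have [p1 _] := piece_diameter se' tu' pE.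
by rewrite -(piece_edges_local q (agree_sub p1 (agree_sym ag)) ad erefl).
Qed.

End Pieces.

(** * Locality of the bidding process *)

Section Untouched.
Context {R : realFieldType} {V : finType}.

Lemma maximal_packing_untouched (E : {set V * V}) (o : V -> R) v :
  ~~ touches E v -> pack_load (maximal_packing E o) v = 0.
Proof.
move=> tv; rewrite /maximal_packing; case: xgetP => [y _ [_ yE _ _]|_].
  rewrite /pack_load big1 // => u _; rewrite !yE ?addr0 //.
    by apply: contraNN tv => uE; apply/touchesP; exists (v, u) => //; left.
  by apply: contraNN tv => uE; apply/touchesP; exists (u, v) => //; right.
by rewrite /pack_load big1 // => u _; rewrite addr0.
Qed.

Lemma maximal_packing_ext (E E' : {set V * V}) (o o' : V -> R) v :
  E = E' -> (forall u, o u = o' u) ->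
  pack_load (maximal_packing E o) v = pack_load (maximal_packing E' o') v.
Proof. by move=> -> oo; congr (pack_load (maximal_packing _ _) v); apply/funext. Qed.

Lemma pending_untouched {Q C : finType} (cl : Q -> C) tau b alpha theta delta
    (E : Q -> {set V * V}) (w : V -> R) t v q : ~~ touches (E q) v ->
  pending (bid_run cl tau b alpha theta delta E w t) v q = 0.
Proof.
move=> tv; elim: t => [|t IH] /=; first exact: offer_untouched.
by case: ifP => // _; case: ifP => // _; exact: offer_untouched.
Qed.

Lemma bid_step_ext {Q C : finType} (cl : Q -> C) tau b alpha theta delta
    (E E' : Q -> {set V * V}) (w w' : V -> R) s s' t v :
  w v = w' v -> (forall q, touches (E q) v = touches (E' q) v) ->
  paid s v = paid s' v -> (forall q, level s v q = level s' v q) ->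
  (forall q, payment cl tau E t s v q = payment cl tau E' t s' v q) ->
  let s1 := bid_step cl tau b alpha theta delta E w t s in
  let s2 := bid_step cl tau b alpha theta delta E' w' t s' in
  [/\ paid s1 v = paid s2 v, forall q, level s1 v q = level s2 v q
    & forall q, acts cl tau t q -> pending s1 v q = pending s2 v q].
Proof.
move=> wE tE paidE levE payE /=.
have offE k k' q : k v q = k' v q -> offer b alpha E w k v q = offer b alpha E' w' k' v q.
  by move=> kE; rewrite /offer tE wE kE.
have raiseE q : raised_level cl tau b alpha E w t s v q =
    raised_level cl tau b alpha E' w' t s' v q.
  by rewrite /raised_level payE levE (offE _ (level s')).
have nextE q : next_level cl tau b alpha theta E w t s v q =
    next_level cl tau b alpha theta E' w' t s' v q.
  rewrite /next_level raiseE /overbid wE; congr (_ - (nat_of_bool (_ < _)%R).*2)%N.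
  by apply: eq_bigr => q' _; exact: offE.
have npE : next_paid cl tau E t s v = next_paid cl tau E' t s' v.
  by rewrite /next_paid paidE; congr (_ + _); apply: eq_bigr.
by split=> // q ->; rewrite npE wE; case: ifP => // _; exact: offE.
Qed.

End Untouched.

Section Locality.
Context {R : realFieldType} {n K : nat}.
Variables (a l : nat) (b : 'I_(2 ^ a) * 'I_n -> R) (alpha theta delta : R).

Implicit Types (q : 'I_(2 ^ a) * 'I_n) (v : 'I_n).

(** At least the distance [8 * i + 6] that [piece_diameter] allows across a piece. *)
Definition period (i : 'I_(2 ^ a)) : nat := (8 * i + 8)%N.

Definition piece_run (e : rel 'I_n) (r : {ffun 'I_n -> 'I_K}) (w : 'I_n -> R) t :=
  bid_run fst period b alpha theta delta (piece_edges l e r) w t.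

Section Run.
Variables (e e' : rel 'I_n) (r r' : {ffun 'I_n -> 'I_K}) (w w' : 'I_n -> R).
Hypothesis se : symmetric e.
Hypothesis se' : symmetric e'.

Let same v d := agree e e' (fun x => (r x, w x)) (fun x => (r' x, w' x)) v d.
Let rad := (4 * 2 ^ a)%N.

Let same_rank v d : same v d -> agree e e' r r' v d.
Proof. by move=> ag x /ag [ee [rr _]]. Qed.

Let same_weight v d : same v d -> w v = w' v.
Proof. by move=> /(_ v (ball_center e v d)) [_ []]. Qed.

Let same_touches v q d : same v (rad.+1 + d) ->
  touches (piece_edges l e r q) v = touches (piece_edges l e' r' q) v.
Proof.
move=> ag; apply: (touches_local l q se se' (d := rad)) => //.
by apply: agree_leq (same_rank ag); rewrite leq_addr.
Qed.

Let same_offer v q d k k' : same v (rad.+1 + d) -> k v q = k' v q ->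
  offer b alpha (piece_edges l e r) w k v q =
  offer b alpha (piece_edges l e' r') w' k' v q.
Proof. by move=> ag kk; rewrite /offer kk (same_touches q ag) (same_weight ag). Qed.

Let acts_radius t (q : 'I_(2 ^ a) * 'I_n) : acts fst period t.+1 q ->
  (t %/ period q.1 * period q.1 + period q.1)%N = t.+1.
Proof.
rewrite /acts => dv; rewrite -[RHS](divnK dv) divnS ?addn_gt0 ?orbT //.
by rewrite dv mulnDl mul1n addnC.
Qed.

Let run1 := piece_run e r w.
Let run2 := piece_run e' r' w'.

(** Pending bids were fixed at the last multiple of the period and so depend on a smaller radius.
    This second invariant supplies the period during which bids travel across the piece. *)
Let local_at t v :
  (same v (rad.+1 + t) ->
     paid (run1 t) v = paid (run2 t) v /\ forall q, level (run1 t) v q = level (run2 t) v q) /\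
  (forall q, same v (rad.+1 + t %/ period q.1 * period q.1) ->
     pending (run1 t) v q = pending (run2 t) v q).
Proof.
elim: t v => [|t IH] v.
  by split=> // q ag; rewrite /= (same_offer (k' := fun _ _ => 0%N) ag).
have pay : same v (rad.+1 + t.+1) -> forall q,
    payment fst period (piece_edges l e r) t.+1 (run1 t) v q =
    payment fst period (piece_edges l e' r') t.+1 (run2 t) v q.
  move=> ag q; rewrite /payment; have [aq|] := boolP (acts fst period t.+1 q); last by [].
  have tq := acts_radius aq.
  have tE := same_touches q ag.
  have [tv|ntv] := boolP (touches (piece_edges l e r q) v); last first.
    have ntv' := ntv; rewrite tE in ntv'.
    exact: etrans (maximal_packing_untouched _ ntv) (esym (maximal_packing_untouched _ ntv')).
  have EE : piece_edges l e r q = piece_edges l e' r' q.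
    apply: (piece_edges_eq (d := rad) se se' _ (leqnn _) tv).
    apply: agree_leq (same_rank ag).
    have tt : (8 * q.1 + 8 <= t.+1)%N by rewrite -tq leq_addl.
    by rewrite addnC addSnnS leq_add2l; apply: leq_trans (leqW tt); rewrite leq_add2l.
  apply: (maximal_packing_ext _ EE) => u.
  have [tu|ntu] := boolP (touches (piece_edges l e r q) u); last first.
    have ntu' := ntu; rewrite EE in ntu'.
    exact: etrans (pending_untouched _ _ _ _ _ _ _ _ ntu)
      (esym (pending_untouched _ _ _ _ _ _ _ _ ntu')).
  (* The pending bid of [u] dates from time [t.+1 - period q.1], and [8 * i + 6] is at most the
     period, so the radii add up to at most [rad.+1 + t.+1]. *)
  have uv : u \in ball e v (8 * q.1 + 6).
    have [p pE pu] := touchesP _ _ tu; have [p1 p2] := piece_diameter se tv pE.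
    by case: pu => <- //; apply: ball_mem_leq p1; rewrite leq_add2l.
  apply: (proj2 (IH u)); apply: (agree_sub uv); apply: agree_leq ag.
  by rewrite -tq /period addnCA leq_add2l addnC leq_add2l leq_add2l.
have main : same v (rad.+1 + t.+1) ->
    [/\ paid (run1 t.+1) v = paid (run2 t.+1) v,
        forall q, level (run1 t.+1) v q = level (run2 t.+1) v q
      & forall q, acts fst period t.+1 q ->
          pending (run1 t.+1) v q = pending (run2 t.+1) v q].
  move=> ag; have ag' : same v (rad.+1 + t) by apply: agree_leq ag; rewrite addnS.
  have [paidE levE] := proj1 (IH v) ag'.
  apply: (bid_step_ext b alpha theta delta (same_weight ag) _ paidE levE (pay ag)) => q.
  exact: (same_touches q ag).
split=> [/main[]|q ag]; first by split.
have [aq|naq] := boolP (acts fst period t.+1 q).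
  have {}ag : same v (rad.+1 + t.+1) by move: ag; rewrite divnK.
  by have [_ _] := main ag; apply.
have pE x y s : pending (bid_step fst period b alpha theta delta x y t.+1 s) v q =
    pending s v q by rewrite /= (negPf naq).
apply: (etrans (pE _ _ _)); apply: etrans (esym (pE _ _ _)).
apply: (proj2 (IH v)); move: ag; rewrite divnS ?addn_gt0 ?orbT //.
by rewrite [(_ %| _)%N](negPf naq).
Qed.

Lemma piece_run_local v t : agree e e' (fun x => (r x, w x)) (fun x => (r' x, w' x)) v
    ((4 * 2 ^ a).+1 + t) ->
  paid (piece_run e r w t) v = paid (piece_run e' r' w' t) v.
Proof. by move=> /(proj1 (local_at t v)) []. Qed.

End Run.

End Locality.

Lemma residual_local {R : realFieldType} {n : nat} {T : Type} (e e' : rel 'I_n)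
    (f f' : 'I_n -> T) (F F' : ('I_n -> R) -> 'I_n -> R) (w w' : 'I_n -> R) d k v :
  (forall w w' v, agree e e' (fun x => (f x, w x)) (fun x => (f' x, w' x)) v d ->
    F w v = F' w' v) ->
  agree e e' (fun x => (f x, w x)) (fun x => (f' x, w' x)) v (k * d) ->
  residual F w k v = residual F' w' k v.
Proof.
move=> FE; elim: k v => [|k IH] v ag; first by have [_ []] := ag v (ball_center e v _).
rewrite /= IH; last by apply: agree_leq ag; rewrite leq_mul2r leqnSn orbT.
congr (_ - _); apply: FE => // x xv.
have xv' : x \in ball e v (k.+1 * d) by apply: ball_mem_leq xv; rewrite mulSn leq_addr.
have [ee [ff _]] := ag x xv'; split=> //; congr pair => //.
by apply: IH; apply: agree_sub xv _; rewrite -mulSn.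
Qed.

(** * Counting rank assignments *)

Section Ranks.
Local Open Scope nat_scope.
Context {V : finType} {K : nat}.
Implicit Types (X Y : {set V}) (r : {ffun V -> 'I_K}).

(** Independence of the ranks on [Y]; probabilities are written as counts with denominators
    cleared. *)
Lemma card_ffun_on_set Y (P : pred 'I_K) :
  #|[set r : {ffun V -> 'I_K} | [forall y in Y, P (r y)]]| * K ^ #|Y| =
  #|P| ^ #|Y| * K ^ #|V|.
Proof.
pose F y : pred 'I_K := if y \in Y then P else predT.
rewrite (_ : #|_| = #|family F|); last first.
  rewrite cardsE; apply: eq_card => r; rewrite !inE; apply/forall_inP/familyP => h y.
    by rewrite /F; case: ifP => // /h.
  by move=> yY; have := h y; rewrite /F yY.
rewrite card_family foldrE big_map big_enum /= (bigID (mem Y)) /=.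
rewrite [X in X * _ * _](eq_bigr (fun=> #|P|)); last by move=> y; rewrite /F => ->.
rewrite [X in _ * X * _](eq_bigr (fun=> K)); last first.
  by move=> y; rewrite /F => /negPf->; rewrite card_ord.
rewrite !prod_nat_const -mulnA -expnD; congr (_ * _ ^ _).
by rewrite addnC cardC.
Qed.

Lemma binomial_two_terms (x c m : nat) : x ^ m.+1 + m.+1 * (c * x ^ m) <= (x + c) ^ m.+1.
Proof.
elim: m => [|m IH]; first by rewrite !expn1 expn0 mul1n muln1.
rewrite [leqRHS]expnS; apply: (@leq_trans ((x + c) * (x ^ m.+1 + m.+1 * (c * x ^ m)))).
  rewrite mulnDl mulnDr -expnS [x ^ m.+2]expnS !mulnA -!addnA leq_add //.
  rewrite [x ^ m.+1]expnS; nia.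
by rewrite leq_mul2l IH orbT.
Qed.

(** This is [(1 - 1 / m) ^ m <= 1 / 2], read off the first two terms of a binomial expansion. *)
Lemma pow_sub_double (c m : nat) : 0 < m -> 2 * (c * m - c) ^ m <= (c * m) ^ m.
Proof.
case: m => // m _; have -> : c * m.+1 = c * m + c by rewrite mulnS addnC.
rewrite addnK; apply: leq_trans (binomial_two_terms _ _ _).
rewrite mul2n -addnn leq_add2l expnS !mulnA leq_mul2r; apply/orP; right.
by rewrite mulnC leq_mul.
Qed.

Lemma card_ord_below (c : nat) : c <= K -> #|[pred k : 'I_K | k < c]| = c.
Proof.
move=> cK; rewrite -sum1_card.
rewrite -(big_ord_widen K (fun=> 1)) //; by rewrite sum1_card card_ord.
Qed.

(** As [c / K = 1 / m], the probability that no rank on [Y] is below [c] is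
    [(1 - 1 / m) ^ #|Y| <= 2 ^- h]. *)
Lemma card_ranks_above Y (c m h : nat) : 0 < c -> 0 < m -> K = c * m -> m * h <= #|Y| ->
  #|[set r : {ffun V -> 'I_K} | [forall y in Y, c <= r y]]| * 2 ^ h <= K ^ #|V|.
Proof.
move=> c0 m0 KE mh.
have K0 : 0 < K by rewrite KE muln_gt0 c0.
have cK : c <= K by rewrite KE leq_pmulr.
have := card_ffun_on_set Y [pred k : 'I_K | c <= k].
have -> : #|[pred k : 'I_K | c <= k]| = K - c.
  have KC := cardC [pred k : 'I_K | k < c]; rewrite card_ord card_ord_below // in KC.
  apply: (canRL (addKn c)); rewrite -[RHS]KC; congr (_ + _).
  by apply: eq_card => k; rewrite !inE -leqNgt.
rewrite /= => NE.
have KY : 0 < K ^ #|Y| by rewrite expn_gt0 K0.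
rewrite -(leq_pmul2r KY) mulnAC NE mulnAC [leqRHS]mulnC leq_mul2r; apply/orP; right.
rewrite -(subnKC mh) !expnD mulnAC leq_mul //; last first.
  by case: (#|Y| - m * h) => // j; rewrite leq_exp2r ?leq_subr.
by rewrite !(expnM _ m) -expnMn; case: h mh => // h _; rewrite leq_exp2r // mulnC KE pow_sub_double.
Qed.

Lemma card_bigcup_leq (I T : finType) (P : pred I) (F : I -> {set T}) :
  #|\bigcup_(i | P i) F i| <= \sum_(i | P i) #|F i|.
Proof.
elim/big_ind2: _ => [|A a B b Aa Bb|//]; first by rewrite cards0.
by rewrite cardsU (leq_trans (leq_subr _ _)) // leq_add.
Qed.

(** Union bound over the subsets of [X] with [t] elements, one of which has all its ranks below
    [c]. *)
Lemma card_ranks_below X (c t : nat) : c <= K ->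
  #|[set r : {ffun V -> 'I_K} | t <= #|[set x in X | r x < c]|]| * K ^ t <=
  'C(#|X|, t) * c ^ t * K ^ #|V|.
Proof.
move=> cK.
pose N (T : {set V}) := [set r : {ffun V -> 'I_K} | [forall y in T, r y < c]].
apply: (@leq_trans (#|\bigcup_(T : {set V} | (T \subset X) && (#|T| == t)) N T| * K ^ t)).
  rewrite leq_mul2r; apply/orP; right; apply: subset_leq_card; apply/fintype.subsetP => r.
  rewrite inE; set S := [set x in X | r x < c] => tS.
  have : 0 < #|[set B : {set V} | B \subset S & #|B| == t]| by rewrite cards_draws bin_gt0.
  case/card_gt0P => T; rewrite inE => /andP[TS Tt]; apply/bigcupP; exists T.
    rewrite Tt andbT; apply: (fintype.subset_trans TS).
    by apply/fintype.subsetP => x; rewrite inE => /andP[].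
  by rewrite inE; apply/forall_inP => y /(fintype.subsetP TS); rewrite inE => /andP[].
apply: (@leq_trans ((\sum_(T : {set V} | (T \subset X) && (#|T| == t)) #|N T|) * K ^ t)).
  by rewrite leq_mul2r card_bigcup_leq orbT.
rewrite big_distrl /= (eq_bigr (fun=> c ^ t * K ^ #|V|)); last first.
  move=> T /andP[_ /eqP Tt]; have := card_ffun_on_set T [pred k : 'I_K | k < c].
  by rewrite card_ord_below // Tt.
by rewrite sum_nat_const -mulnA -cards_draws cardsE.
Qed.

(** The [h] largest factors of the factorial are all at least [h]. *)
Lemma leq_expn_fact2 (h : nat) : h ^ h <= (2 * h)`!.
Proof.
rewrite mul2n -addnn; have := @ffact_fact (h + h) h; rewrite leq_addr => /(_ isT) <-.
rewrite addnK; apply: (@leq_trans ((h + h) ^_ h)); last by rewrite leq_pmulr ?fact_gt0.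
have gen j : j <= h -> h ^ j <= (h + j) ^_ j.
  elim: j => // j IH jh; rewrite addnS ffactnS expnS /= leq_mul ?IH ?(ltnW jh) //.
  by rewrite leqW // leq_addr.
exact: gen.
Qed.

Lemma binomial_expn_leq (x h : nat) : 'C(x, 2 * h) * h ^ h <= x ^ (2 * h).
Proof.
apply: leq_trans (_ : 'C(x, 2 * h) * (2 * h)`! <= _); first by rewrite leq_mul2l leq_expn_fact2 orbT.
rewrite bin_ffact; elim: (2 * h) => // t IH.
by rewrite ffactnSr expnSr leq_mul // leq_subr.
Qed.

(* Compare both sides with a threshold rank [2 ^ (l - s)]: some element of [Y] is
   below it, and few elements of [X] are. *)
Lemma card_many_early (l g : nat) X Y : #|V| < 2 ^ l -> K = 2 ^ l ->
  #|X| <= 2 ^ g * #|Y| ->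
  #|[set r : {ffun V -> 'I_K} | 16 * 4 ^ g * (3 * l + 1) ^ 2 <
      #|[set x in X | [forall y in Y, r x <= r y]]|]| * 2 ^ (3 * l) <= K ^ #|V|.
Proof.
move=> Vl KE XY; set L := 3 * l + 1; set D := _ * L ^ 2.
have L0 : 0 < L by rewrite /L addn1.
(* For a small [Y], already [#|X|] is within the bound and no assignment is bad. *)
have [YL|YL] := ltnP #|Y| L.
  rewrite (_ : [set r | _] = finset.set0) ?cards0 //; apply/setP => r; rewrite !inE.
  apply/negbTE; rewrite -leqNgt; apply: (@leq_trans #|X|).
    by apply: subset_leq_card; apply/fintype.subsetP => x; rewrite inE => /andP[].
  apply: (leq_trans XY); rewrite /D; apply: leq_mul.
    apply: (@leq_trans (4 ^ g)); last by rewrite leq_pmull.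
    by case: (g) => // j; rewrite leq_exp2r.
  by apply: (leq_trans (ltnW YL)); rewrite leq_pmulr.
(* At the threshold [c = K / 2 ^ s], between [L] and [2 * L] elements of [Y] are expected below
   [c]. *)
pose s := trunc_log 2 (#|Y| %/ L).
have YL0 : 0 < #|Y| %/ L by rewrite divn_gt0.
have sY : 2 ^ s * L <= #|Y|.
  by apply: leq_trans (leq_trunc_div #|Y| L); rewrite leq_mul2r trunc_logP ?orbT.
have Ys : #|Y| < 2 ^ s.+1 * L.
  have := trunc_log_ltn (#|Y| %/ L) (isT : 1 < 2); rewrite -/s => lt.
  apply: leq_trans (ltn_ceil #|Y| L0) _; by rewrite leq_mul2r lt orbT.
have sl : s <= l.
  rewrite -(leq_exp2l (m := 2)) //; apply: leq_trans (ltnW Vl).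
  by apply: leq_trans (max_card (mem Y)); apply: leq_trans sY; rewrite leq_pmulr.
pose c := 2 ^ (l - s).
have KcE : K = c * 2 ^ s by rewrite /c -expnD subnK.
have c0 : 0 < c by rewrite expn_gt0.
have cK : c <= K by rewrite KcE leq_pmulr // expn_gt0.
have K0 : 0 < K by rewrite KE expn_gt0.
(* Chosen as [h = 2 * (2 ^ g.+1 * L) ^ 2]: since [#|X| * c / K <= 2 ^ g.+1 * L], the bound of
   [binomial_expn_leq] makes [2 * h] ranks below [c] in [X] an event of probability at most
   [2 ^- h]. *)
pose h := 2 * 4 ^ g.+1 * L ^ 2.
have Dh : D = 2 * h by rewrite /D /h (expnS 4 g); move: (4 ^ g) (L ^ 2) => x y; ring.
have E1 : #|[set r : {ffun V -> 'I_K} | [forall y in Y, c <= r y]]| * 2 ^ L <= K ^ #|V|.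
  by apply: card_ranks_above sY => //; rewrite expn_gt0.
have E2 : #|[set r : {ffun V -> 'I_K} | 2 * h <= #|[set x in X | r x < c]|]| * 2 ^ h
    <= K ^ #|V|.
  set N := #|_|.
  have h0 : 0 < h ^ h by rewrite expn_gt0 /h !muln_gt0 !expn_gt0 L0.
  have N1 : N * K ^ (2 * h) * h ^ h <= (#|X| * c) ^ (2 * h) * K ^ #|V|.
    apply: (@leq_trans ('C(#|X|, 2 * h) * c ^ (2 * h) * K ^ #|V| * h ^ h)).
      by rewrite leq_mul2r card_ranks_below ?orbT.
    rewrite expnMn [leqLHS]mulnAC leq_mul2r; apply/orP; right.
    by rewrite mulnAC leq_mul2r binomial_expn_leq orbT.
  have Xc : #|X| * c <= 2 ^ g.+1 * L * K.
    apply: (@leq_trans (2 ^ g * (2 ^ s.+1 * L) * c)).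
      by rewrite leq_mul2r (leq_trans XY) ?orbT // leq_mul2l (ltnW Ys) orbT.
    by rewrite KcE !expnS; apply: eq_leq; ring.
  have N2 : (#|X| * c) ^ (2 * h) * 2 ^ h <= K ^ (2 * h) * h ^ h.
    apply: (@leq_trans ((2 ^ g.+1 * L * K) ^ (2 * h) * 2 ^ h)).
      by rewrite leq_mul2r; apply/orP; right; case: (2 * h) => // j; rewrite leq_exp2r.
    rewrite !(expnM _ 2 h) -!expnMn; apply: eq_leq; congr (_ ^ _).
    have four : 4 ^ g.+1 = (2 ^ g.+1) ^ 2 by rewrite -expnM mulnC expnM.
    by rewrite /h four; move: (2 ^ g.+1) => x; ring.
  have KK : 0 < K ^ (2 * h) by rewrite expn_gt0 K0.
  rewrite -(leq_pmul2r KK) -(leq_pmul2r h0).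
  apply: (@leq_trans (N * K ^ (2 * h) * h ^ h * 2 ^ h)); first by apply: eq_leq; ring.
  apply: (@leq_trans ((#|X| * c) ^ (2 * h) * K ^ #|V| * 2 ^ h)).
    by rewrite leq_mul2r N1 orbT.
  by rewrite mulnAC -[leqRHS]mulnA [leqRHS]mulnC leq_mul2r N2 orbT.
(* Two failures of probability at most [2 ^- L] each, with [L = 3 * l + 1], add up to
   [2 ^- (3 * l)]. *)
rewrite -(leq_pmul2r (isT : 0 < 2)) -mulnA -expnSr -[(3 * l).+1]addn1 -/L.
apply: (@leq_trans ((#|[set r : {ffun V -> 'I_K} | [forall y in Y, c <= r y]]| +
    #|[set r : {ffun V -> 'I_K} | 2 * h <= #|[set x in X | r x < c]|]|) * 2 ^ L)).
  rewrite leq_mul2r; apply/orP; right.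
  apply: (@leq_trans #|[set r : {ffun V -> 'I_K} | [forall y in Y, c <= r y]] :|:
      [set r : {ffun V -> 'I_K} | 2 * h <= #|[set x in X | r x < c]|]|); last first.
    by rewrite cardsU leq_subr.
  apply: subset_leq_card; apply/fintype.subsetP => r; rewrite !inE Dh => many.
  have [//|/forall_inPn[y yY]] := boolP [forall y in Y, c <= r y].
  rewrite -ltnNge /= => yc; apply: leq_trans (ltnW many) _.
  apply: subset_leq_card; apply/fintype.subsetP => x; rewrite !inE.
  by move=> /andP[-> /forall_inP/(_ y yY)] /leq_ltn_trans; apply.
rewrite mulnDl muln2 -addnn leq_add //; apply: leq_trans E2.
rewrite leq_mul2l leq_exp2l //; apply/orP; right.
by rewrite /h expnS; nia.
Qed.

End Ranks.

Section GoodRanks.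
Local Open Scope nat_scope.
Context {n : nat}.
Variables (a l : nat).

Definition early_bound (i : nat) : nat := 16 * 4 ^ growth_exp a l i * (3 * l + 1) ^ 2.

Definition good_ranks (e : rel 'I_n) (r : {ffun 'I_n -> 'I_(2 ^ l)}) : bool :=
  [forall v, forall i : 'I_(2 ^ a),
    slow_at a l e v i ==> (#|early e r v i| <= early_bound i)].

(** Union bound over [n * 2 ^ a] pairs, each failing with probability at most [2 ^- (3 * l)], where
    [n] and [2 ^ a] are at most [2 ^ l]. *)
Lemma card_bad_ranks (e : rel 'I_n) : n < 2 ^ l -> a <= l ->
  #|[set r | ~~ good_ranks e r]| * n <= (2 ^ l) ^ n.
Proof.
move=> nl al.
pose bad v (i : 'I_(2 ^ a)) := [set r : {ffun 'I_n -> 'I_(2 ^ l)} |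
  slow_at a l e v i && (early_bound i < #|early e r v i|)].
have badE v i : #|bad v i| * 2 ^ (3 * l) <= (2 ^ l) ^ n.
  have [sl|nsl] := boolP (slow_at a l e v i); last first.
    rewrite (_ : bad v i = finset.set0) ?cards0 //; apply/setP => r.
    by rewrite !inE (negPf nsl).
  have [_ XY] := andP sl.
  have := @card_many_early _ (2 ^ l) l (growth_exp a l i) (ball e v (4 * i.+1))
    (ball e v (4 * i)).
  rewrite card_ord => /(_ nl erefl XY); apply: leq_trans.
  rewrite leq_mul2r; apply/orP; right; apply: subset_leq_card.
  by apply/fintype.subsetP => r; rewrite inE => /andP[_]; rewrite finset.in_set.
have sub : [set r | ~~ good_ranks e r] \subset \bigcup_(p : 'I_n * 'I_(2 ^ a)) bad p.1 p.2.
  apply/fintype.subsetP => r; rewrite inE negb_forall => /existsP[v].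
  rewrite negb_forall => /existsP[i]; rewrite negb_imply -ltnNge => br.
  by apply/bigcupP; exists (v, i) => //; rewrite finset.in_set.
have P0 : 0 < 2 ^ (3 * l) by rewrite expn_gt0.
rewrite -(leq_pmul2r P0) mulnAC.
apply: (@leq_trans (n * 2 ^ a * (2 ^ l) ^ n * n)).
  rewrite leq_mul2r; apply/orP; right.
  apply: (@leq_trans (\sum_(p : 'I_n * 'I_(2 ^ a)) #|bad p.1 p.2| * 2 ^ (3 * l))).
    rewrite -big_distrl /= leq_mul2r; apply/orP; right.
    by apply: leq_trans (subset_leq_card sub) _; exact: card_bigcup_leq.
  apply: (@leq_trans (\sum_(p : 'I_n * 'I_(2 ^ a)) (2 ^ l) ^ n)).
    by apply: leq_sum => p _; exact: badE.
  by rewrite sum_nat_const card_prod !card_ord.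
rewrite mulnAC [leqRHS]mulnC leq_mul2r; apply/orP; right.
rewrite (_ : 3 * l = l + l + l) ?expnD; last by rewrite -[RHS]addnA !mulSn mul0n addn0.
by rewrite mulnAC leq_mul ?leq_exp2l // leq_mul // ltnW.
Qed.

End GoodRanks.

(** * The covering algorithm: locality, correctness and success probability *)

Lemma sum_pair_fst (R : pzSemiRingType) (I J : finType) (P : pred (I * J)) (f : I -> R) :
  \sum_(q | P q) f q.1 = \sum_i #|[set j | P (i, j)]|%:R * f i.
Proof.
rewrite (eq_bigl (fun q => xpredT q.1 && P (q.1, q.2))); last by case.
rewrite -(pair_big_dep xpredT (fun i j => P (i, j)) (fun i _ => f i)) /=.
by apply: eq_bigr => i _; rewrite sumr_const cardsE mulr_natl.
Qed.

Section Algorithm.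
Context {R : realType} {n : nat}.
Variables (a l t m : nat) (eps : R).

(** There are [2 ^ a] classes, one for each index, so [theta] times their number is exactly
    [delta]. *)
Let alpha : R := 2 ^+ a.
Let delta : R := 2 ^- a.
Let theta : R := 2 ^- (2 * a).

(** The budget [theta / 4] is split evenly among the [2 ^ a] indices, and then among the at most
    [early_bound] pieces of one index. *)
Definition base_bid (q : 'I_(2 ^ a) * 'I_n) : R :=
  theta / (4 * 2 ^+ a * (early_bound a l q.1)%:R).

Definition reduction (e : rel 'I_n) (r : {ffun 'I_n -> 'I_(2 ^ l)}) (w : 'I_n -> R) :
    'I_n -> R :=
  paid (piece_run l base_bid alpha theta delta e r w t).

Definition cover_alg : rand_alg R n (2 ^ l) := fun e w r v =>
  residual (reduction e r) w m.*2 v <= eps / 4 * w v.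

(** The inequality is strict because [T] rounds reveal only edges at nodes within distance [T - 1],
    while [agree] also compares the edges at the boundary of its ball. *)
Lemma cover_alg_local (T : nat) : (m.*2 * ((4 * 2 ^ a).+1 + t) < T)%N ->
  local_in_rounds T cover_alg.
Proof.
move=> mT e e' w w' r r' v [se _] [se' _] ee' wr.
have ag : agree e e' (fun x => (r x, w x)) (fun x => (r' x, w' x)) v
    (m.*2 * ((4 * 2 ^ a).+1 + t)).
  move=> x xv; case: T mT ee' wr => // T mT ee' wr; split=> [y|].
    by apply: ee' => //; apply: ball_mem_leq xv.
  have [|-> ->//] := wr x; by apply: ball_mem_leq xv; apply: ltnW.
have [_ [_ wv]] := ag v (ball_center e v _).
have runE u u' x : agree e e' (fun x => (r x, u x)) (fun x => (r' x, u' x)) x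
    ((4 * 2 ^ a).+1 + t) -> reduction e r u x = reduction e' r' u' x.
  exact: piece_run_local.
have resE := residual_local runE ag.
exact: (congr2 (fun x y => x <= eps / 4 * y) resE wv).
Qed.

Hypothesis a_ge2 : (2 <= a)%N.
Hypothesis n_lt : (n < 2 ^ l)%N.

Let early_bound_gt0 i : (0 < early_bound a l i)%N.
Proof. by rewrite /early_bound !muln_gt0 !expn_gt0 addn1. Qed.

Lemma base_bid_ge0 q : 0 <= base_bid q.
Proof. by rewrite divr_ge0 ?invr_ge0 ?mulr_ge0 ?exprn_ge0. Qed.

Lemma base_bid_sum e (r : {ffun 'I_n -> 'I_(2 ^ l)}) v : symmetric e -> good_ranks a e r ->
  \sum_(q | touches (piece_edges l e r q) v) base_bid q <= theta / 4.
Proof.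
move=> se /forallP gr.
pose f (i : 'I_(2 ^ a)) : R := theta / (4 * 2 ^+ a * (early_bound a l i)%:R).
apply: (@le_trans _ _ (\sum_(i < 2 ^ a) theta / (4 * 2 ^+ a))); last first.
  rewrite sumr_const card_ord -[_ *+ (2 ^ a)]mulr_natr natrX.
  have a0 : (2 : R) ^+ a != 0 by rewrite expf_neq0.
  by rewrite (_ : _ * _ = theta / 4) //; field.
rewrite (sum_pair_fst (fun q => touches (piece_edges l e r q) v) f).
apply: ler_sum => i _.
have cD : (#|[set c | touches (piece_edges l e r (i, c)) v]| <= early_bound a l i)%N.
  apply: piece_touch_count => //; first exact: ltnW.
  by move=> x sx; have /forallP/(_ i)/implyP := gr x; apply.
have D0 : 0 < (early_bound a l i)%:R :> R by rewrite ltr0n.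
have -> : f i = theta / (4 * 2 ^+ a) / (early_bound a l i)%:R by rewrite /f invfM mulrA.
rewrite mulrCA ler_piMr // ?ler_pdivrMr ?mul1r ?ler_nat //.
by rewrite divr_ge0 ?invr_ge0 ?mulr_ge0 ?exprn_ge0.
Qed.

(** Bounds the drops: [alpha = 2 ^ (3 * a) * theta], hence [d * (theta / 2) = alpha]. *)
Let d : nat := 2 ^ (3 * a + 1).

(** [k] bounds the levels in pieces of index [i]: by the first condition a bid at level [k.+1] alone
    would exceed the fraction [theta]. The second one is the count of packings in
    [bid_run_tight]. *)
Hypothesis t_large : forall i : 'I_(2 ^ a), exists2 k,
  (4 * 2 ^ a * early_bound a l i < 2 ^ (a * k.+1))%N &
  (2 * k + 4 * d < t %/ period i)%N.

Let alpha_ge4 : 4 <= alpha.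
Proof. by rewrite /alpha -natrX ler_nat (leq_exp2l (m := 2) 2). Qed.

Let theta_gt0 : 0 < theta. Proof. by rewrite invr_gt0 exprn_gt0. Qed.

Let theta_le1 : theta <= 1. Proof. by rewrite invf_le1 ?exprn_gt0 // exprn_ege1 // ler1n. Qed.

Let theta_delta : theta * #|'I_(2 ^ a)|%:R <= delta.
Proof.
rewrite card_ord natrX /theta /delta mul2n -addnn exprD invfM -mulrA mulVf ?mulr1 //.
Qed.

Let theta_base (i : 'I_(2 ^ a)) c k : (4 * 2 ^ a * early_bound a l i < 2 ^ (a * k.+1))%N ->
  theta < base_bid (i, c) * alpha ^+ k.+1.
Proof.
move=> lt; rewrite /base_bid /= mulrAC ltr_pdivlMr; last first.
  by rewrite !mulr_gt0 ?exprn_gt0 ?ltr0n.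
by rewrite ltr_pM2l // /alpha -exprM -!natrX -!natrM ltr_nat.
Qed.

Let theta_drops : theta / 4 + alpha < d.+1%:R * (theta / 2).
Proof.
have -> : alpha = 2 ^+ (3 * a) * theta.
  by rewrite /alpha /theta -[(3 * a)%N]/((1 + 2) * a)%N mulnDl mul1n exprD mulfK ?expf_neq0.
rewrite -[d.+1%:R]natr1 /d natrX exprD expr1; move: theta_gt0.
by move: (2 ^+ (3 * a)) => x th0; have -> : (x * 2 + 1) * (theta / 2) = x * theta + theta / 2; [field | lra].
Qed.

Lemma reduction_packing e r w : simple_graph e -> good_ranks a e r ->
  (forall v, 0 <= w v) ->
  is_packing_load (fun p => e p.1 p.2) (@reduction e r w).
Proof.
move=> [se _] gr w0; apply: (paid_packing _ _ _ _ w0 base_bid_ge0 alpha_ge4).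
- move=> q p; exact: piece_edges_irr.
- by move=> q p; rewrite inE => /and3P[].
Qed.

Lemma reduction_le e r w : simple_graph e -> good_ranks a e r ->
  (forall v, 0 <= w v) -> forall v, @reduction e r w v <= w v.
Proof.
move=> [se _] gr w0 v; apply: (paid_le _ _ w0 base_bid_ge0 alpha_ge4 theta_gt0 theta_le1).
- exact: theta_delta.
- move=> q p; exact: piece_edges_irr.
- by move=> x; exact: base_bid_sum.
Qed.

Lemma reduction_tight e r w : simple_graph e -> good_ranks a e r ->
  (forall v, 0 <= w v) -> forall p, e p.1 p.2 ->
  (1 - delta) * w p.1 <= @reduction e r w p.1 \/
  (1 - delta) * w p.2 <= @reduction e r w p.2.
Proof.
move=> [se ie] gr w0.
have tight (q : 'I_(2 ^ a) * 'I_n) p : p \in piece_edges l e r q ->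
    (1 - delta) * w p.1 <= @reduction e r w p.1 \/
    (1 - delta) * w p.2 <= @reduction e r w p.2.
  move=> pE; case: q pE => i c pE; have [k ek tk] := t_large i.
  apply: (bid_run_tight w0 base_bid_ge0 alpha_ge4 theta_gt0 theta_le1 theta_delta _ _ pE
    (theta_base c ek) theta_drops tk).
  - move=> q' p'; exact: piece_edges_irr.
  - by move=> x; exact: base_bid_sum.
move=> p ep; have [q [/tight //|/tight []]] := @piece_edges_cover n _ a l e r p se ie ep.
- by right.
- by left.
Qed.

Lemma cover_alg_correct e r w : simple_graph e -> good_ranks a e r ->
  0 < eps < 1 -> delta ^+ m <= eps / 4 -> (forall v, 0 <= w v) ->
  [forall x, forall y, e x y ==> (x \in output_set cover_alg e w r) ||
                                 (y \in output_set cover_alg e w r)]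
  && (set_weight w (output_set cover_alg e w r) <= (2 + eps) * OPT_vc e w).
Proof.
move=> sg gr e01 de w0.
have outE : output_set cover_alg e w r = tight_set (reduction e r) w eps m.*2.
  by apply/setP => v; rewrite !inE.
have d0 : 0 <= delta by rewrite invr_ge0 exprn_ge0.
have d1 : delta <= 1 by rewrite invf_le1 ?exprn_gt0 // exprn_ege1 // ler1n.
have pk u (u0 : forall v, 0 <= u v) := reduction_packing sg gr u0.
have le u (u0 : forall v, 0 <= u v) := reduction_le sg gr u0.
have tg u (u0 : forall v, 0 <= u v) := reduction_tight sg gr u0.
rewrite outE; apply/andP; split.
  apply/forallP => x; apply/forallP => y; apply/implyP => exy.
  exact: (tight_set_cover d0 d1 w0 pk le tg de (exy : e (x, y).1 (x, y).2)).
have weight (S : {set 'I_n}) :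
    [forall x, forall y, e x y ==> (x \in S) || (y \in S)] ->
    set_weight w (tight_set (reduction e r) w eps m.*2) <= (2 + eps) * set_weight w S.
  move=> /forallP cov; apply: (tight_set_weight w0 pk le _ e01) => -[x y] /= exy.
  by have /forallP/(_ y)/implyP := cov x; apply.
(* The bound holds for every cover, including the default set of all vertices, hence for the
   minimum. *)
rewrite /OPT_vc; apply: (big_ind (fun z => set_weight w _ <= (2 + eps) * z)) => [|y z yE zE|].
- by apply: weight; apply/forallP => x; apply/forallP => y; rewrite !inE implybT.
- by rewrite minEle; case: ifP.
- exact: weight.
Qed.

Lemma cover_alg_success e w : simple_graph e -> (0 < n)%N -> (a <= l)%N ->
  0 < eps < 1 -> delta ^+ m <= eps / 4 -> (forall v, 0 <= w v) ->
  1 - n%:R ^- 1 <= success_prob cover_alg e w eps.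
Proof.
move=> sg n0 al e01 de w0; rewrite /success_prob.
set G := [set r | _].
have sub : ~: G \subset [set r | ~~ good_ranks a e r].
  apply/fintype.subsetP => r; rewrite finset.in_setC => nG; rewrite finset.in_set.
  by apply: contraNN nG => gr; rewrite /G finset.in_set; exact: cover_alg_correct.
have cF : #|{ffun 'I_n -> 'I_(2 ^ l)}| = ((2 ^ l) ^ n)%N by rewrite card_ffun !card_ord.
have bad : (#|~: G| * n <= (2 ^ l) ^ n)%N.
  by apply: leq_trans (card_bad_ranks e n_lt al); rewrite leq_mul2r subset_leq_card ?orbT.
have GE : #|G|%:R + #|~: G|%:R = ((2 ^ l) ^ n)%:R :> R by rewrite -natrD cardsC cF.
have K0 : (0 : R) < ((2 ^ l) ^ n)%:R by rewrite ltr0n !expn_gt0.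
have n0R : (0 : R) < n%:R by rewrite ltr0n.
rewrite cF ler_pdivlMr // mulrBl mul1r lerBlDr -[in leLHS]GE lerD2l expr1 mulrC.
by rewrite ler_pdivlMr // -natrM ler_nat.
Qed.

End Algorithm.

(** * Choice of the parameters and number of rounds of one run *)

Section Rounds.
Local Open Scope nat_scope.

Definition id_bits (n : nat) : nat := (trunc_log 2 n).+1.

(* The exponent [a] of the raise factor [2 ^ a]; it is of the order of [log (log n)]. *)
Definition rate (n : nat) : nat := (trunc_log 2 (id_bits n)).+1 %/ 10.

(** The first term pays for the part of the levels due to ball growth, the second for
    polylogarithmic factors, drops and rounding, whatever the index of the piece. *)
Definition ticks (a l : nat) : nat := (64 * (l %/ a + 2 ^ a)) %/ a + 2 ^ (4 * a + 8).

Definition reduction_rounds (a l : nat) : nat := (4 * 2 ^ a).+1 + ticks a l.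

Lemma id_bits_gt n : n < 2 ^ id_bits n.
Proof. exact: trunc_log_ltn. Qed.

Lemma id_bits_le n : 0 < n -> 2 ^ (id_bits n).-1 <= n.
Proof. exact: trunc_logP. Qed.

Lemma rate_gt n : id_bits n < 2 ^ (10 * rate n + 10).
Proof.
apply: leq_trans (trunc_log_ltn _ (isT : 1 < 2)) _; rewrite leq_exp2l // /rate.
by rewrite -mulnSr mulnC ltnW // ltn_ceil.
Qed.

Lemma rate_le n : 2 ^ (10 * rate n) <= 2 * id_bits n.
Proof.
apply: (@leq_trans (2 ^ (trunc_log 2 (id_bits n)).+1)).
  by rewrite leq_exp2l // /rate mulnC leq_trunc_div.
by rewrite expnS leq_mul2l trunc_logP.
Qed.

Lemma rate_unbounded k : exists n0, forall n, n0 <= n -> k <= rate n.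
Proof.
exists (2 ^ 2 ^ (10 * k)) => n nk; rewrite /rate leq_divRL // mulnC ltnW // ltnS.
rewrite trunc_log_max // /id_bits ltnW // ltnS trunc_log_max //.
Qed.

Lemma ticks_large a l i : 3 <= a -> l < 2 ^ (10 * a + 10) -> i < 2 ^ a -> exists2 k,
  4 * 2 ^ a * early_bound a l i < 2 ^ (a * k.+1) &
  2 * k + 4 * 2 ^ (3 * a + 1) < ticks a l %/ (8 * i + 8).
Proof.
move=> a3 la ia; have a0 : 0 < a by apply: leq_trans a3.
rewrite /early_bound; set j := trunc_log 2 i; set g := growth_exp a l i.
(* The quantity to exceed is below [2 ^ (21 * a + 30 + 2 * g)], and [21 * a + 30 <= 51 * a]; the
   quotient, with the successor in [k.+1], covers [2 * g]. *)
exists (51 + (2 * g) %/ a).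
  have b2 : (3 * l + 1) ^ 2 < 2 ^ (20 * a + 24).
    rewrite (_ : 20 * a + 24 = (10 * a + 12) * 2) ?expnM ?ltn_exp2r //; last by clear; lia.
    have -> : 2 ^ (10 * a + 12) = 4 * 2 ^ (10 * a + 10).
      by rewrite -[4]/(2 ^ 2) -expnD; congr (2 ^ _); clear; lia.
    by move: (2 ^ (10 * a + 10)) la => P; clear; lia.
  apply: (@leq_trans (4 * 2 ^ a * (16 * 4 ^ g * 2 ^ (20 * a + 24)))).
    by rewrite ltn_pmul2l ?ltn_pmul2l // ?muln_gt0 ?expn_gt0.
  rewrite (_ : 4 * 2 ^ a * (16 * 4 ^ g * 2 ^ (20 * a + 24)) =
      2 ^ (2 + a + (4 + 2 * g + (20 * a + 24)))); last by rewrite !expnD expnM.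
  rewrite leq_exp2l //; have := ltn_ceil (2 * g) a0.
  by rewrite mulnC; move: (_ %/ _) => x; clear -a3; nia.
rewrite leq_divRL ?addn_gt0 ?orbT //.
have ij : i.+1 <= 2 * 2 ^ j by rewrite -expnS; exact: trunc_log_ltn.
have ja : 2 ^ j <= 2 ^ a.
  have [i0|i0] := posnP i; first by rewrite /j i0 trunc_log0 expn0 expn_gt0.
  by apply: leq_trans (ltnW ia); exact: trunc_logP.
(* The index cancels here: [g] is about [l / (a * 2 ^ j)], and the period is of order [2 ^ j]. *)
have jg : 2 ^ j * g <= l %/ a + 2 ^ a.
  rewrite /g /growth_exp -/j mulnS addnC leq_add // divnMA mulnC.
  exact: leq_trunc_div.
have X : (8 * i + 8) * (2 * (2 * g %/ a)) <= (64 * (l %/ a + 2 ^ a)) %/ a.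
  rewrite leq_divRL //; apply: (@leq_trans (64 * (2 ^ j * g))); last by rewrite leq_mul2l.
  have := leq_trunc_div (2 * g) a; move: (2 * g %/ a) (2 ^ j) ij => x J iJ xa.
  apply: (@leq_trans (16 * J * 2 * (x * a))); first by clear -iJ; nia.
  by apply: (@leq_trans (16 * J * 2 * (2 * g))); [rewrite leq_mul2l xa orbT | clear; lia].
(* [103 = 2 * 51 + 1], where the last unit accounts for the strict inequality. *)
have Y : (8 * i + 8) * (103 + 4 * 2 ^ (3 * a + 1)) <= 2 ^ (4 * a + 8).
  have e3 : 2 ^ 11 <= 2 ^ (3 * a + 2) by rewrite leq_exp2l //; clear -a3; lia.
  have e2 : 2 ^ (3 * a + 2) = 2 * 2 ^ (3 * a + 1).
    by rewrite -expnS; congr (2 ^ _); clear; lia.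
  have -> : 2 ^ (4 * a + 8) = 128 * (2 ^ a * 2 ^ (3 * a + 1)).
    by rewrite -[128]/(2 ^ 7) -!expnD; congr (2 ^ _); clear; lia.
  move: e3; rewrite e2 -[2 ^ 11]/2048; move: (2 ^ a) ia (2 ^ (3 * a + 1)) => A iA B e3.
  apply: (@leq_trans (8 * A * (8 * B))).
    by rewrite leq_mul //; [clear -iA | clear -e3]; lia.
  by clear; nia.
apply: (@leq_trans ((8 * i + 8) * (2 * (2 * g %/ a)) + (8 * i + 8) * (103 + 4 * 2 ^ (3 * a + 1)))).
  by rewrite -mulnDr mulnC leq_mul2l; apply/orP; right; move: (2 ^ _) (_ %/ _) => x y; clear; lia.
by rewrite /ticks leq_add.
Qed.

(** The main term of [ticks] gives [64 * l]. The rest is [O(a ^ 2 * 2 ^ (4 * a))], at most [l] since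
    [2 ^ (6 * a + 10) <= 2 ^ (10 * a) <= 2 * l] for [3 <= a]. *)
Lemma reduction_rounds_le a l : 3 <= a -> 2 ^ (10 * a) <= 2 * l ->
  a * a * reduction_rounds a l <= 65 * l.
Proof.
move=> a3 la; rewrite /reduction_rounds /ticks.
set X := 64 * _; have XX : a * (X %/ a) <= X by rewrite mulnC leq_trunc_div.
have l1 : a * (l %/ a) <= l by rewrite mulnC leq_trunc_div.
have aX : a * X <= 64 * l + 64 * (a * 2 ^ a).
  rewrite /X mulnCA mulnDr mulnDr leq_add2r leq_mul2l l1 orbT //.
have aA : a <= 2 ^ a by apply: ltnW; exact: ltn_expl.
have e6 : 2 ^ (6 * a + 10) <= 2 * l.
  by apply: leq_trans la; rewrite leq_exp2l //; clear -a3; lia.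
have e4 : 2 ^ (4 * a + 8) = 256 * (2 ^ a * 2 ^ a * 2 ^ a * 2 ^ a).
  by rewrite -[256]/(2 ^ 8) -!expnD; congr (2 ^ _); clear; lia.
have {}e6 : 1024 * (2 ^ a * 2 ^ a * 2 ^ a * 2 ^ a) * (2 ^ a * 2 ^ a) <= 2 * l.
  by apply: leq_trans e6; rewrite -[1024]/(2 ^ 10) -!expnD leq_exp2l //; clear; lia.
have A8 : 8 <= 2 ^ a by rewrite -[8]/(2 ^ 3) leq_exp2l.
rewrite e4; move: (X %/ a) (2 ^ a) (l %/ a) XX aX l1 aA e6 A8 => x A y XX aX l1 aA e6 A8.
set A4 := A * A * A * A in e6 *.
have AA : 0 < A * A by clear -A8; nia.
have A4A : A <= A4 by rewrite /A4 -mulnA -mulnA leq_pmulr //; clear -A8; nia.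
have aaA : a * a <= A * A by rewrite leq_mul.
have bX : a * (a * x) <= 64 * l + 64 * (a * A) by apply: leq_trans aX; rewrite leq_mul2l XX orbT.
have aAA : a * A <= A * A by rewrite leq_mul2r aA orbT.
have c1 : a * a * ((4 * A).+1 + (x + 256 * A4)) =
    a * (a * x) + a * a * (4 * A + 1 + 256 * A4) by clear; lia.
rewrite c1; apply: (@leq_trans (64 * l + 64 * (A * A) + A * A * (261 * A4))).
  rewrite leq_add ?(leq_trans bX) ?leq_add2l ?leq_mul2l ?aAA ?orbT // leq_mul //.
  by clear -A4A A8; lia.
have A41 : 1 <= A4 by apply: leq_trans A4A; apply: leq_trans A8.
have c2 : A * A * 64 <= A * A * (64 * A4) by rewrite leq_mul2l leq_pmulr ?orbT.
by move: (A * A) AA c2 e6 => Z Z0 c2 e6; clear -c2 e6; nia.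
Qed.

End Rounds.

(** * Asymptotic estimates of the number of rounds *)

Section Asymptotics.
Context {R : realType}.
Implicit Types (n : nat) (eps : R).

Lemma ln2_le1 : ln (2 : R) <= 1.
Proof. by apply: (@le_ln1Dx R 1); lra. Qed.

Lemma ln2_ge_half : 1 / 2 <= ln (2 : R).
Proof.
have : ln (1 + - (1 / 2)) <= - (1 / 2) :> R by apply: le_ln1Dx; lra.
rewrite (_ : 1 + - (1 / 2) = 2^-1); last by field.
by rewrite lnV ?posrE // lerN2.
Qed.

Definition repetitions n eps : nat :=
  (Num.truncn (ln (4 / eps) / ((rate n)%:R * ln 2))).+1.

Lemma repetitionsP n eps : (0 < rate n)%N -> 0 < eps < 1 ->
  (2 ^- rate n) ^+ repetitions n eps <= eps / 4.
Proof.
move=> a0 /andP[e0 e1]; rewrite exprVn -exprM -[leRHS]invrK lef_pV2; first last.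
- by rewrite posrE invr_gt0 divr_gt0.
- by rewrite posrE exprn_gt0.
rewrite invf_div -ler_ln ?posrE ?divr_gt0 ?exprn_gt0 //.
rewrite lnXn // -[ln 2 *+ _]mulr_natr natrM mulrA -ler_pdivrMl; last first.
  by rewrite mulr_gt0 ?ltr0n //; have := ln2_ge_half; lra.
by rewrite mulrC [ln 2 * _]mulrC; apply: ltW; exact: truncnS_gt.
Qed.

Lemma repetitions_le n eps : (3 <= rate n)%N -> 0 < eps < 1 ->
  (repetitions n eps)%:R <= 2 + 2 * ln (1 / eps) / (rate n)%:R.
Proof.
move=> a3 /andP[e0 e1]; have l2 := ln2_ge_half; have l1 := ln2_le1.
have a3R : 3 <= (rate n)%:R :> R by rewrite ler_nat.
rewrite /repetitions; move: (rate n)%:R a3R => a a3R.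
have x0 : 0 <= ln (1 / eps) by rewrite ln_ge0 // ler_pdivlMr // mul1r ltW.
have q0 : 0 < a * ln (2 : R) by rewrite mulr_gt0 //; lra.
have lnq : ln (4 / eps) = 2 * ln 2 + ln (1 / eps).
  rewrite !lnM ?posrE ?invr_gt0 // ln1 add0r; congr (_ + _).
  by rewrite (_ : 4 = 2 ^+ 2) ?lnXn ?mulr_natl // expr2; ring.
have y0 : 0 <= ln (4 / eps) / (a * ln 2).
  by rewrite divr_ge0 // ?(ltW q0) // lnq; lra.
have [yle _] := andP (truncn_itv y0).
rewrite -natr1 -lerBrDr; apply: (le_trans yle).
rewrite ler_pdivrMr // lnq; set x := ln (1 / eps) in x0 *.
have -> : (2 + 2 * x / a - 1) * (a * ln 2) = a * ln 2 + x * (2 * ln 2).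
  by field; lra.
have : x * 1 <= x * (2 * ln 2) by rewrite ler_wpM2l //; lra.
have : 2 * ln (2 : R) <= a * ln 2 by rewrite ler_wpM2r //; lra.
lra.
Qed.

Lemma id_bits_ge16 n : (3 <= rate n)%N -> (16 <= id_bits n)%N.
Proof.
move=> a3; rewrite -(leq_pmul2l (isT : 0 < 2)%N); apply: leq_trans (rate_le n).
by rewrite -[(2 * 16)%N]/(2 ^ 5)%N leq_exp2l //; move: (rate n) a3 => a; clear; lia.
Qed.

Lemma rate_pos_size n : (3 <= rate n)%N -> (0 < n)%N.
Proof. by case: n => // /id_bits_ge16; rewrite /id_bits trunc_log0. Qed.

Lemma id_bits_ln n : (3 <= rate n)%N -> (id_bits n)%:R <= 4 * ln (n%:R : R).
Proof.
move=> a3; have l16 := id_bits_ge16 a3; have n0 := rate_pos_size a3.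
have l2 := ln2_ge_half.
have nR : 0 < n%:R :> R by rewrite ltr0n.
have : ln (2 ^+ (id_bits n).-1) <= ln (n%:R : R).
  by rewrite ler_ln ?posrE ?exprn_gt0 // -natrX ler_nat id_bits_le.
rewrite lnXn // -[ln 2 *+ _]mulr_natr.
have : (id_bits n)%:R = (id_bits n).-1%:R + 1 :> R by rewrite natr1 prednK.
have : 15 <= (id_bits n).-1%:R :> R.
  by rewrite ler_nat; move: (id_bits n) l16 => l; clear; lia.
move: (id_bits n).-1%:R => k k15 -> kn.
have : 1 / 2 * k <= ln 2 * k by rewrite ler_wpM2r //; lra.
lra.
Qed.

(** [ln n] is at most [id_bits n], which is below [2 ^ (10 * a + 10)], and
    [10 * a + 10 <= 20 * a]. *)
Lemma rate_lnln n : (3 <= rate n)%N ->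
  0 < ln (ln (n%:R : R)) <= 20 * (rate n)%:R.
Proof.
move=> a3; have l16 := id_bits_ge16 a3; have n0 := rate_pos_size a3.
have l1 := ln2_le1; have l2 := ln2_ge_half; have ll := id_bits_ln a3.
have nR : 0 < n%:R :> R by rewrite ltr0n.
have l16R : 16 <= (id_bits n)%:R :> R by rewrite ler_nat.
have ln1 : 1 < ln (n%:R : R) by lra.
have ln0 : 0 < ln (n%:R : R) by lra.
rewrite ln_gt0 //=.
have lnl : ln (n%:R : R) <= (id_bits n)%:R.
  have : ln (n%:R : R) <= ln (2 ^+ id_bits n).
    by rewrite ler_ln ?posrE ?exprn_gt0 // -natrX ler_nat ltnW ?id_bits_gt.
  move/le_trans; apply; rewrite lnXn // -[ln 2 *+ _]mulr_natr.
  by rewrite -[leRHS]mul1r ler_wpM2r.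
have : ln (ln (n%:R : R)) <= ln (2 ^+ (10 * rate n + 10)).
  rewrite ler_ln ?posrE ?exprn_gt0 //; apply: (le_trans lnl).
  by rewrite -natrX ler_nat ltnW ?rate_gt.
move/le_trans; apply; rewrite lnXn // -[ln 2 *+ _]mulr_natr.
apply: (@le_trans _ _ (1 * (10 * rate n + 10)%:R)); first by rewrite ler_wpM2r.
by rewrite mul1r -natrM ler_nat; move: (rate n) a3 => a; clear; lia.
Qed.

Definition rounds n eps : nat :=
  ((repetitions n eps).*2 * reduction_rounds (rate n) (id_bits n)).+1.

(** Constants: [260 = 65 * 4] from [reduction_rounds_le] and [id_bits_ln], [400 = 20 ^ 2] from
    [rate_lnln], and [80 = 2 * 2 * 20] from the number of runs. *)
Lemma rounds_le n eps : (3 <= rate n)%N -> 0 < eps < 1 ->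
  (rounds n eps)%:R <= 80 * (260 * 400) * (ln (n%:R) / ln (ln (n%:R)) ^+ 2 +
    ln (n%:R) * ln (1 / eps) / ln (ln (n%:R)) ^+ 3) :> R.
Proof.
move=> a3 e01; have mle := repetitions_le a3 e01; have lle := id_bits_ln a3.
have /andP[L0 La] := rate_lnln a3; have [e0 e1] := andP e01.
have x0 : 0 <= ln (1 / eps) by rewrite ln_ge0 // ler_pdivlMr // mul1r ltW.
have Sle : (rate n)%:R * (rate n)%:R * (reduction_rounds (rate n) (id_bits n))%:R <=
    65 * (id_bits n)%:R :> R.
  by rewrite -!natrM ler_nat reduction_rounds_le // rate_le.
have S1 : 1 <= (reduction_rounds (rate n) (id_bits n))%:R :> R by rewrite ler1n.
have a3R : 3 <= (rate n)%:R :> R by rewrite ler_nat.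
rewrite /rounds -natr1 natrM -mul2n natrM.
move: (repetitions n eps)%:R (reduction_rounds _ _)%:R (rate n)%:R (id_bits n)%:R
  (ln (1 / eps)) mle Sle S1 a3R lle La x0 => m S a l x mle Sle S1 a3R lle La x0.
move: (ln n%:R) lle L0 La => N lle; move: (ln N) => L L0 La.
have a0 : 0 < a by lra.
have N0 : 0 <= N.
  have : 0 <= a * a * S by rewrite !mulr_ge0 //; lra.
  lra.
pose u := a^-1; pose v := L^-1.
have u0 : 0 < u by rewrite invr_gt0.
have v0 : 0 < v by rewrite invr_gt0.
have uv : u <= 20 * v.
  by rewrite /u /v ler_pdivlMr // mulrC ler_pdivrMr.
have Su : S <= 260 * N * u ^+ 2.
  rewrite /u exprVn ler_pdivlMr ?exprn_gt0 // mulrC expr2; apply: (le_trans Sle); lra.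
have mu : 2 * m + 1 <= 5 + 80 * (x * v).
  have : x * u <= x * (20 * v) by rewrite ler_wpM2l.
  rewrite -[2 * x / a]/(2 * x * u) in mle; lra.
have u2 : u ^+ 2 <= 400 * v ^+ 2.
  by rewrite (_ : 400 * v ^+ 2 = (20 * v) ^+ 2); [rewrite lerXn2r // nnegrE; lra | ring].
have Sv : S <= (260 * 400) * (N * v ^+ 2).
  apply: (le_trans Su); rewrite -mulrA.
  have : N * u ^+ 2 <= N * (400 * v ^+ 2) by rewrite ler_wpM2l.
  lra.
have Nv : 0 <= N * v ^+ 2 by rewrite mulr_ge0 ?exprn_ge0 // ltW.
have xv : 0 <= x * v by rewrite mulr_ge0 // ltW.
apply: (@le_trans _ _ ((5 + 80 * (x * v)) * ((260 * 400) * (N * v ^+ 2)))).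
  apply: (@le_trans _ _ ((2 * m + 1) * S)); first by rewrite [leRHS]mulrDl mul1r lerD2l.
  apply: (@le_trans _ _ ((5 + 80 * (x * v)) * S)); first by rewrite ler_wpM2r //; lra.
  by rewrite ler_wpM2l //; lra.
have -> : N / L ^+ 2 + N * x / L ^+ 3 = N * v ^+ 2 + x * v * (N * v ^+ 2).
  by rewrite /v; field; lra.
have : 0 <= x * v * (N * v ^+ 2) by rewrite mulr_ge0.
lra.
Qed.

End Asymptotics.

Theorem theorem2 (R : realType) :
  exists (C : R) (c : nat) (n0 : nat)
         (K : nat -> R -> nat) (T : nat -> R -> nat)
         (A : forall (n : nat) (eps : R), rand_alg R n (K n eps)),
    0 < C /\ (1 <= c)%N /\
    forall (n : nat) (eps : R), (n0 <= n)%N -> 0 < eps < 1 ->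
      [/\ (T n eps)%:R <=
            C * (ln (n%:R) / (ln (ln (n%:R))) ^+ 2
                 + ln (n%:R) * ln (1 / eps) / (ln (ln (n%:R))) ^+ 3),
          local_in_rounds (T n eps) (A n eps)
        & forall (e : rel 'I_n) (w0 : 'I_n -> R),
            simple_graph e -> (forall v, 0 <= w0 v) ->
            1 - (n%:R ^- c) <= success_prob (A n eps) e w0 eps].
Proof.
have [n0 rate3] := rate_unbounded 3.
(* The exponent [1] reflects the fraction [1 / n] of bad rank assignments in [card_bad_ranks]. *)
exists (80 * (260 * 400)), 1%N, n0, (fun n _ => 2 ^ id_bits n)%N, (@rounds R).
exists (fun n (eps : R) => @cover_alg R n (rate n) (id_bits n) (ticks (rate n) (id_bits n))
  (repetitions n eps) eps).
split; first by rewrite !mulr_gt0.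
split=> // n eps /rate3 a3 e01; split; first exact: rounds_le.
  by apply: cover_alg_local; rewrite ltnS.
move=> e w0 sg w0_ge0; have a0 : (0 < rate n)%N by apply: leq_trans a3.
apply: cover_alg_success => //.
- exact: ltnW.
- exact: id_bits_gt.
- by move=> i; apply: ticks_large (ltn_ord i) => //; exact: rate_gt.
- exact: rate_pos_size.
- apply: ltnW; apply: leq_trans (ltn_expl (rate n) (isT : 1 < 2)%N) _.
  rewrite -(leq_pmul2l (isT : 0 < 2)%N) -expnS; apply: leq_trans (rate_le n).
  by rewrite leq_exp2l //; move: (rate n) a0 => a; clear; lia.
- exact: repetitionsP.
Qed.
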